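(* Let $X$ be a real Banach space which is $\omega$-LUR. Assume that (i) there exists a big point $u\in S_X$, and (ii) for each $\epsilon>0$ there exists a closed subspace $Z_\epsilon\subset X$ of codimension $1$ and a linear projection of $X$ onto $Z_\epsilon$ of norm at most $1+\epsilon$. Then $X$ is isometrically a Hilbert space.
   Context: $X$ is $\omega$-LUR if every $x\in S_X$ is an $\omega$-LUR point: for every $(x_n)\subset B_X$ with $\|x+x_n\|\to2$ one has $x_n\to x$ weakly. $\mathcal{G}_X$ is the group of surjective linear isometries of $X$; $x\in S_X$ is a big point if $\overline{\mathrm{conv}}(\{T(x):T\in\mathcal{G}_X\})=B_X$. *)

(* Defs.v *)
From Stdlib Require Import Reals List.
Open Scope R_scope.
Set Implicit Arguments.

Record NormedSpace := {
  carrier :> Type;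
  vzero : carrier;
  vadd : carrier -> carrier -> carrier;
  vopp : carrier -> carrier;
  vscal : R -> carrier -> carrier;
  vnorm : carrier -> R;
  vadd_assoc : forall x y z, vadd x (vadd y z) = vadd (vadd x y) z;
  vadd_comm : forall x y, vadd x y = vadd y x;
  vadd_0 : forall x, vadd x vzero = x;
  vadd_opp : forall x, vadd x (vopp x) = vzero;
  vscal_assoc : forall a b x, vscal a (vscal b x) = vscal (a * b) x;
  vscal_1 : forall x, vscal 1 x = x;
  vscal_distr_l : forall a x y, vscal a (vadd x y) = vadd (vscal a x) (vscal a y);
  vscal_distr_r : forall a b x, vscal (a + b) x = vadd (vscal a x) (vscal b x);
  vnorm_eq0 : forall x, vnorm x = 0 -> x = vzero;
  vnorm_scal : forall a x, vnorm (vscal a x) = Rabs a * vnorm x;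
  vnorm_triangle : forall x y, vnorm (vadd x y) <= vnorm x + vnorm y
}.

Arguments vzero {n}.
Arguments vadd {n}.
Arguments vopp {n}.
Arguments vscal {n}.
Arguments vnorm {n}.

Definition vsub {X : NormedSpace} (x y : X) : X := vadd x (vopp y).

Definition vcv {X : NormedSpace} (u : nat -> X) (l : X) : Prop :=
  Un_cv (fun n => vnorm (vsub (u n) l)) 0.

Definition complete (X : NormedSpace) : Prop :=
  forall u : nat -> X,
    (forall eps, eps > 0 -> exists N, forall n m, (n >= N)%nat -> (m >= N)%nat ->
        vnorm (vsub (u n) (u m)) < eps) ->
    exists l, vcv u l.

Definition is_linear {X Y : NormedSpace} (T : X -> Y) : Prop :=
  (forall x y, T (vadd x y) = vadd (T x) (T y)) /\
  (forall a x, T (vscal a x) = vscal a (T x)).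

Definition bounded_functional {X : NormedSpace} (f : X -> R) : Prop :=
  (forall x y, f (vadd x y) = f x + f y) /\
  (forall a x, f (vscal a x) = a * f x) /\
  (exists C, forall x, Rabs (f x) <= C * vnorm x).

Definition weak_cv {X : NormedSpace} (u : nat -> X) (l : X) : Prop :=
  forall f : X -> R, bounded_functional f -> Un_cv (fun n => f (u n)) (f l).

Definition omega_LUR_point {X : NormedSpace} (x : X) : Prop :=
  vnorm x = 1 /\
  forall xn : nat -> X, (forall n, vnorm (xn n) <= 1) ->
    Un_cv (fun n => vnorm (vadd x (xn n))) 2 -> weak_cv xn x.

Definition omega_LUR (X : NormedSpace) : Prop :=
  forall x : X, vnorm x = 1 -> omega_LUR_point x.

Definition surj_lin_isometry {X : NormedSpace} (T : X -> X) : Prop :=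
  is_linear T /\ (forall y, exists x, T x = y) /\ (forall x, vnorm (T x) = vnorm x).

Fixpoint comb {X : NormedSpace} (l : list (R * X)) : X :=
  match l with
  | nil => vzero
  | (a, x) :: l' => vadd (vscal a x) (comb l')
  end.

Definition conv {X : NormedSpace} (A : X -> Prop) (y : X) : Prop :=
  exists l : list (R * X),
    (forall p, In p l -> 0 <= fst p /\ A (snd p)) /\
    fold_right Rplus 0 (map fst l) = 1 /\
    y = comb l.

Definition closure {X : NormedSpace} (A : X -> Prop) (y : X) : Prop :=
  forall eps, eps > 0 -> exists a, A a /\ vnorm (vsub y a) < eps.

Definition big_point {X : NormedSpace} (x : X) : Prop :=
  vnorm x = 1 /\
  forall y : X,
    closure (conv (fun z => exists T, surj_lin_isometry T /\ T x = z)) y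
    <-> vnorm y <= 1.

Definition subspace {X : NormedSpace} (Z : X -> Prop) : Prop :=
  Z vzero /\ (forall x y, Z x -> Z y -> Z (vadd x y)) /\
  (forall a x, Z x -> Z (vscal a x)).

Definition closed_subset {X : NormedSpace} (Z : X -> Prop) : Prop :=
  forall (u : nat -> X) l, (forall n, Z (u n)) -> vcv u l -> Z l.

Definition codim1 {X : NormedSpace} (Z : X -> Prop) : Prop :=
  exists v : X, ~ Z v /\
    forall x, exists z t, Z z /\ x = vadd z (vscal t v).

Definition lin_projection_onto {X : NormedSpace} (Z : X -> Prop) (P : X -> X) : Prop :=
  is_linear P /\ (forall x, Z (P x)) /\ (forall z, Z z -> P z = z).

Definition op_norm_le {X : NormedSpace} (P : X -> X) (c : R) : Prop :=
  forall x, vnorm (P x) <= c * vnorm x.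

Definition is_hilbert (X : NormedSpace) : Prop :=
  exists ip : X -> X -> R,
    (forall x y z, ip (vadd x y) z = ip x z + ip y z) /\
    (forall a x y, ip (vscal a x) y = a * ip x y) /\
    (forall x y, ip x y = ip y x) /\
    (forall x, ip x x = vnorm x ^ 2).

(* Main.v *)
Require Import Defs.
From Stdlib Require Import Reals ZArith List Lra Lia Classical ClassicalEpsilon.
From mathcomp Require classical_sets.
Open Scope R_scope.

(** If [vnorm (x + T v)] is close to 2 for an isometry [T], then so is [vnorm (T^-1 x + v)]; hence the
    weak LUR property gives, for all unit vectors [x] and [v], isometries [T n] such that
    [T n v -> x] and [(T n)^-1 x -> v] weakly. Transporting the projections [y |-> y - f(y) v] by
    [T n] and using weak lower semicontinuity of the norm, one finds for every [x <> 0] a linear form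
    [g_x] with [g_x(x) = 1] and [vnorm (y - g_x(y) x) <= vnorm y]; by rotundity [g_x(y) x] is the
    nearest point to [y] on the line of [x], so Birkhoff orthogonality [y _|_ x] amounts to
    [g_x(y) = 0].

    In dimension at least 3 this left-linearity forces smoothness, so [y _|_ x] also amounts to
    [f_y(x) = 0] for the support functional [f_y]. The correspondence [y |-> f_y] then preserves
    incidence, hence is projectively linear, and on each plane orthogonality is given by a bilinear
    form [B]. The norm is a multiple of [sqrt (B(y,y))]: an antisymmetric part of [B] would turn the
    unit circle into a spiral. In dimension 2 the largest inscribed ellipse is invariant under the
    isometries, which act almost transitively. Either way [x] and [ker g_x] satisfy Pythagoras'
    theorem, and [vnorm x ^ 2 * g_x(y)] is the inner product. *)

(** Orthogonality is linear on one side only, and in a plane this costs nothing: every normed plane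
    has a norm-one projection with any prescribed kernel line, as planes with an l_p norm show. So
    the projections carry no information in dimension 2, and there the isometries must be used a
    second time.

    The isometries give weak limits only, and the kernel direction of a projection of norm at most
    [1 + eps] changes with [eps]. Hence orbits must be controlled from an arbitrary unit vector and
    not just from the big point, and limits are extracted for finitely many scalars at a time;
    linearity is recovered afterwards from uniqueness of nearest points.

    In dimension 3, a point without a unique support functional would yield two directions sharing
    one orthogonal plane; an incidence argument multiplies such directions, while compactness and
    rotundity provide an extremal one. Once smoothness holds, incidence is linear on either side,
    and the coordinate changes induced by [y |-> f_y] are, up to a factor, ring endomorphisms of the
    reals, of which the identity is the only one. *)

Local Notation "x +v y" := (vadd x y) (at level 50, left associativity).
Local Notation "a *v x" := (vscal a x) (at level 40, left associativity).
Local Notation "x -v y" := (vsub x y) (at level 50, left associativity).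
Local Notation "0v" := (vzero) (at level 0).

(** * Vector arithmetic *)

Lemma vadd_cancel (X : NormedSpace) (x y z : X) : x +v z = y +v z -> x = y.
Proof.
  intros H.
  rewrite <- (vadd_0 X x), <- (vadd_0 X y), <- (vadd_opp X z), !vadd_assoc, H.
  reflexivity.
Qed.

Lemma vscal_0l (X : NormedSpace) (x : X) : 0 *v x = 0v.
Proof.
  apply (vadd_cancel X _ _ (0 *v x)).
  rewrite <- vscal_distr_r, (vadd_comm X 0v), vadd_0. f_equal; ring.
Qed.

Lemma vscal_0r (X : NormedSpace) (a : R) : a *v (0v : X) = 0v.
Proof. rewrite <- (vscal_0l X 0v), vscal_assoc, Rmult_0_r. reflexivity. Qed.

Lemma vopp_scal (X : NormedSpace) (x : X) : vopp x = (-1) *v x.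
Proof.
  apply (vadd_cancel X _ _ x).
  rewrite (vadd_comm X (vopp x)), vadd_opp.
  rewrite <- (vscal_1 X x) at 2. rewrite <- vscal_distr_r.
  replace (-1 + 1) with 0 by ring. rewrite vscal_0l. reflexivity.
Qed.

(** Reflected syntax for vector identities: an expression is determined by its coefficients on a
    list of atoms, so a goal in [X] reduces to one real identity per atom, left to [ring] or
    [field]. The starting index [k] in [vcombine] and [vcoef_eq] follows the recursion on the
    list. *)
Inductive vexpr :=
| VVar (n : nat)
| VZero
| VAdd (a b : vexpr)
| VOpp (a : vexpr)
| VScal (r : R) (a : vexpr).

Fixpoint veval (X : NormedSpace) (env : list X) (e : vexpr) : X :=
  match e with
  | VVar n => nth n env 0v
  | VZero => 0v
  | VAdd a b => veval X env a +v veval X env b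
  | VOpp a => vopp (veval X env a)
  | VScal r a => r *v veval X env a
  end.

Fixpoint vcoef (e : vexpr) (k : nat) : R :=
  match e with
  | VVar n => if Nat.eqb n k then 1 else 0
  | VZero => 0
  | VAdd a b => vcoef a k + vcoef b k
  | VOpp a => - vcoef a k
  | VScal r a => r * vcoef a k
  end.

Fixpoint vcombine (X : NormedSpace) (env : list X) (c : nat -> R) (k : nat) : X :=
  match env with
  | nil => 0v
  | x :: env' => c k *v x +v vcombine X env' c (S k)
  end.

Fixpoint vcoef_eq (n : nat) (e1 e2 : vexpr) (k : nat) : Prop :=
  match n with
  | O => True
  | S n' => vcoef e1 k = vcoef e2 k /\ vcoef_eq n' e1 e2 (S k)
  end.

Lemma vcombine_zero (X : NormedSpace) (env : list X) (c : nat -> R) (k : nat) :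
  (forall j, (k <= j)%nat -> c j = 0) -> vcombine X env c k = 0v.
Proof.
  revert k; induction env as [|x env IH]; intros k H; simpl; trivial.
  rewrite H, IH, vscal_0l, vadd_0; trivial; intros; apply H; lia.
Qed.

Lemma vcombine_var (X : NormedSpace) (env : list X) (n k : nat) :
  vcombine X env (vcoef (VVar (n + k))) k = nth n env 0v.
Proof.
  revert n k; induction env as [|x env IH]; intros [|n] k; cbn [vcombine nth]; trivial.
  - simpl. rewrite Nat.eqb_refl, vcombine_zero, vadd_0, vscal_1; trivial.
    intros j Hj. destruct (Nat.eqb_spec k j); trivial; lia.
  - replace (S n + k)%nat with (n + S k)%nat by lia. rewrite IH. cbn [vcoef].
    destruct (Nat.eqb_spec (n + S k) k); [lia|].
    rewrite vscal_0l, vadd_comm, vadd_0. reflexivity.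
Qed.

Lemma vcombine_add (X : NormedSpace) (env : list X) (c d : nat -> R) (k : nat) :
  vcombine X env (fun j => c j + d j) k = vcombine X env c k +v vcombine X env d k.
Proof.
  revert k; induction env as [|x env IH]; intros k; simpl.
  - rewrite vadd_0; trivial.
  - rewrite IH, vscal_distr_r, !vadd_assoc. f_equal.
    rewrite <- !vadd_assoc. f_equal. apply vadd_comm.
Qed.

Lemma vcombine_scal (X : NormedSpace) (env : list X) (a : R) (c : nat -> R) (k : nat) :
  vcombine X env (fun j => a * c j) k = a *v vcombine X env c k.
Proof.
  revert k; induction env as [|x env IH]; intros k; simpl.
  - rewrite vscal_0r; trivial.
  - rewrite IH, vscal_distr_l, vscal_assoc; trivial.
Qed.

Lemma vcombine_ext (X : NormedSpace) (env : list X) (c d : nat -> R) (k : nat) :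
  (forall j, c j = d j) -> vcombine X env c k = vcombine X env d k.
Proof.
  intros H; revert k; induction env as [|x env IH]; intros k; simpl; trivial.
  rewrite H, IH; trivial.
Qed.

Lemma veval_vcombine (X : NormedSpace) (env : list X) (e : vexpr) :
  veval X env e = vcombine X env (vcoef e) 0.
Proof.
  induction e as [n| |a IHa b IHb|a IH|r a IH]; simpl veval.
  - rewrite <- (vcombine_var X env n 0). rewrite Nat.add_0_r. reflexivity.
  - symmetry; apply vcombine_zero; trivial.
  - rewrite IHa, IHb, <- vcombine_add. reflexivity.
  - rewrite IH, vopp_scal, <- vcombine_scal. apply vcombine_ext; intros; simpl; ring.
  - rewrite IH, <- vcombine_scal. reflexivity.
Qed.

Lemma veval_eq (X : NormedSpace) (env : list X) (e1 e2 : vexpr) :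
  vcoef_eq (length env) e1 e2 0 -> veval X env e1 = veval X env e2.
Proof.
  intros H. rewrite !veval_vcombine.
  revert H. generalize 0%nat as k.
  induction env as [|x env IH]; intros k H; simpl; trivial.
  destruct H as [H1 H2]. rewrite H1, (IH _ H2). reflexivity.
Qed.

Ltac vatom_index x env :=
  match env with
  | x :: _ => constr:(O)
  | _ :: ?env' => let n := vatom_index x env' in constr:(S n)
  end.

Ltac vatoms t env :=
  lazymatch t with
  | vadd ?a ?b => let env := vatoms a env in vatoms b env
  | vsub ?a ?b => let env := vatoms a env in vatoms b env
  | vopp ?a => vatoms a env
  | vscal _ ?a => vatoms a env
  | vzero => env
  | _ => match env with
         | _ => let n := vatom_index t env in env
         | _ => constr:(t :: env)
         end
  end.

Ltac vreify t env :=
  lazymatch t with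
  | vadd ?a ?b => let a := vreify a env in let b := vreify b env in constr:(VAdd a b)
  | vsub ?a ?b => let a := vreify a env in let b := vreify b env in constr:(VAdd a (VOpp b))
  | vopp ?a => let a := vreify a env in constr:(VOpp a)
  | vscal ?r ?a => let a := vreify a env in constr:(VScal r a)
  | vzero => constr:(VZero)
  | _ => let n := vatom_index t env in constr:(VVar n)
  end.

Ltac vcoefs :=
  lazymatch goal with
  | |- @eq ?T ?a ?b =>
    let X := lazymatch T with carrier ?X => X end in
    let env := vatoms a (@nil (carrier X)) in
    let env := vatoms b env in
    let e1 := vreify a env in
    let e2 := vreify b env in
    change (veval X env e1 = veval X env e2);
    apply veval_eq;
    cbn [vcoef_eq vcoef length Nat.eqb]; repeat split
  end.

Ltac vlin := vcoefs; try ring; try (field; try lra).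

Lemma Rabs_m1 : Rabs (-1) = 1.
Proof. rewrite Rabs_left; lra. Qed.

Lemma vnorm_0 (X : NormedSpace) : vnorm (0v : X) = 0.
Proof. rewrite <- (vscal_0l X 0v), vnorm_scal, Rabs_R0. ring. Qed.

Lemma vnorm_opp (X : NormedSpace) (x : X) : vnorm (vopp x) = vnorm x.
Proof. rewrite vopp_scal, vnorm_scal, Rabs_m1. ring. Qed.

Lemma vnorm_ge0 (X : NormedSpace) (x : X) : 0 <= vnorm x.
Proof.
  pose proof (vnorm_triangle X x (vopp x)) as H.
  rewrite vadd_opp, vnorm_0, vnorm_opp in H. lra.
Qed.

Lemma vnorm_gt0 (X : NormedSpace) (x : X) : x <> 0v -> 0 < vnorm x.
Proof.
  intros H. destruct (vnorm_ge0 X x) as [|E]; trivial.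
  elim H; apply vnorm_eq0; auto.
Qed.

Lemma vnorm_sub_le (X : NormedSpace) (x y : X) : vnorm (x -v y) <= vnorm x + vnorm y.
Proof. rewrite <- (vnorm_opp X y). apply vnorm_triangle. Qed.

Lemma vnorm_sub_ge (X : NormedSpace) (x y : X) : vnorm x - vnorm y <= vnorm (x -v y).
Proof.
  pose proof (vnorm_triangle X (x -v y) y) as H.
  replace (x -v y +v y) with x in H by vlin. lra.
Qed.

Lemma vsub_eq0 (X : NormedSpace) (x y : X) : x -v y = 0v -> x = y.
Proof. intros H. replace x with (x -v y +v y) by vlin. rewrite H. vlin. Qed.

(** * Norming functionals *)

Definition linear_form {X : NormedSpace} (f : X -> R) : Prop :=
  (forall x y, f (x +v y) = f x + f y) /\ (forall a x, f (a *v x) = a * f x).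

(** A partial linear form is kept as a graph, without a type for its domain, so that the union of a
    chain is a plain union. Single-valuedness needs no clause: domination at [(0v, r - s)] gives
    it. *)
Definition dominated_graph {X : NormedSpace} (S : X * R -> Prop) : Prop :=
  (forall x r y s, S (x, r) -> S (y, s) -> S (x +v y, r + s)) /\
  (forall a x r, S (x, r) -> S (a *v x, a * r)) /\
  (forall x r, S (x, r) -> r <= vnorm x).

(** The one-dimensional step of Hahn-Banach. Domination wants the value [c] at [v] above every
    [r - vnorm (x -v v)] and below every [vnorm (x +v v) - r]; by the triangle inequality no lower
    bound exceeds an upper one, and [c] is the supremum of the lower ones. *)
Lemma dominated_graph_extend (X : NormedSpace) (S : X * R -> Prop) (v : X) :
  dominated_graph S -> S (0v, 0) ->
  exists S' : X * R -> Prop, dominated_graph S' /\ (forall p, S p -> S' p) /\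
    exists c, S' (v, c).
Proof.
  intros [HA [HM HD]] H0.
  destruct (completeness (fun a => exists x r, S (x, r) /\ a = r - vnorm (x -v v)))
    as [c [Hub Hlub]].
  - exists (vnorm (0v +v v)). intros a [x [r [Hx ->]]].
    pose proof (HD _ _ Hx). pose proof (vnorm_triangle X (x -v v) v) as H1.
    replace (x -v v +v v) with x in H1 by vlin.
    replace (0v +v v) with v by vlin. lra.
  - eexists. exists 0v, 0. split; [exact H0|reflexivity].
  - assert (L : forall x r, S (x, r) -> r - c <= vnorm (x -v v)).
    { intros x r Hx. assert (r - vnorm (x -v v) <= c); [|lra].
      apply Hub. exists x, r; auto. }
    assert (U : forall x r, S (x, r) -> r + c <= vnorm (x +v v)).
    { intros x r Hx. assert (c <= vnorm (x +v v) - r); [|lra].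
      apply Hlub. intros a [y [s [Hy ->]]].
      pose proof (HD _ _ (HA _ _ _ _ Hx Hy)).
      pose proof (vnorm_triangle X (x +v v) (y -v v)) as T.
      replace (x +v v +v (y -v v)) with (x +v y) in T by vlin. lra. }
    exists (fun p => exists x r t, S (x, r) /\ p = (x +v t *v v, r + t * c)).
    split; [split; [|split]|split].
    + intros x r y s [x' [r' [t [Hx E]]]] [y' [s' [t' [Hy E']]]].
      injection E as -> ->. injection E' as -> ->.
      exists (x' +v y'), (r' + s'), (t + t'). split; [auto|].
      f_equal; [vlin|ring].
    + intros a x r [x' [r' [t [Hx E]]]]. injection E as -> ->.
      exists (a *v x'), (a * r'), (a * t). split; [auto|]. f_equal; [vlin|ring].
    + intros x r [x' [r' [t [Hx E]]]]. injection E as -> ->.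
      destruct (Rtotal_order t 0) as [Ht|[->|Ht]].
      * pose proof (L _ _ (HM (/ (- t)) _ _ Hx)) as H.
        replace (x' +v t *v v) with ((- t) *v (/ (- t) *v x' -v v)) by vlin.
        rewrite vnorm_scal, Rabs_pos_eq by lra.
        apply (Rmult_le_compat_l (- t)) in H; [|lra].
        replace (r' + t * c) with (- t * (/ - t * r' - c)) by (field; lra). exact H.
      * replace (x' +v 0 *v v) with x' by vlin. rewrite Rmult_0_l, Rplus_0_r. auto.
      * pose proof (U _ _ (HM (/ t) _ _ Hx)) as H.
        replace (x' +v t *v v) with (t *v (/ t *v x' +v v)) by vlin.
        rewrite vnorm_scal, Rabs_pos_eq by lra.
        apply (Rmult_le_compat_l t) in H; [|lra].
        replace (r' + t * c) with (t * (/ t * r' + c)) by (field; lra). exact H.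
    + intros [x r] Hx. exists x, r, 0. split; trivial. f_equal; [vlin|ring].
    + exists c, 0v, 0, 1. split; trivial. f_equal; [vlin|ring].
Qed.

Lemma norming_functional (X : NormedSpace) (w : X) :
  exists f : X -> R, linear_form f /\ (forall x, Rabs (f x) <= vnorm x) /\ f w = vnorm w.
Proof.
  set (base := fun p : X * R => exists t, p = (t *v w, t * vnorm w)).
  (* The line of [w] is adjoined to [A] rather than required inside it: the empty chain has empty
     union, which must qualify too. *)
  destruct (@classical_sets.Zorn_bigcup (X * R)%type
    (fun A : X * R -> Prop => dominated_graph (fun p => base p \/ A p))) as [A [HA Hmax]].
  - intros F HF Htot.
    assert (Hb : forall x r y s, base (x, r) -> base (y, s) -> base (x +v y, r + s)).
    { intros x r y s [t E] [t' E']. injection E as -> ->. injection E' as -> ->.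
      exists (t + t'). f_equal; [vlin|ring]. }
    split; [|split].
    + intros x r y s [Hx|[B FB Bx]] [Hy|[C FC Cy]].
      * left; auto.
      * destruct (proj1 (HF _ FC) x r y s) as [|]; auto. right; exists C; auto.
      * destruct (proj1 (HF _ FB) x r y s) as [|]; auto. right; exists B; auto.
      * destruct (Htot _ _ FB FC) as [H|H].
        -- destruct (proj1 (HF _ FC) x r y s) as [|]; auto. right; exists C; auto.
        -- destruct (proj1 (HF _ FB) x r y s) as [|]; auto. right; exists B; auto.
    + intros a x r [[t E]|[B FB Bx]].
      * injection E as -> ->. left. exists (a * t). f_equal; [vlin|ring].
      * destruct (proj1 (proj2 (HF _ FB)) a x r) as [|]; auto. right; exists B; auto.
    + intros x r [[t E]|[B FB Bx]].
      * injection E as -> ->. rewrite vnorm_scal. apply Rmult_le_compat_r.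
        apply vnorm_ge0. apply RRle_abs.
      * apply (proj2 (proj2 (HF _ FB))); auto.
  - set (S := fun p => base p \/ A p) in HA.
    assert (S0 : S (0v, 0)) by (left; exists 0; f_equal; [vlin|ring]).
    assert (Hdom : forall v, exists r, S (v, r)).
    { intros v. apply NNPP. intros Hv.
      destruct (dominated_graph_extend X S v HA S0) as [S' [HS' [HSS' [c Hc]]]].
      apply (Hmax S').
      - split; [intros p Hp; apply HSS'; right; exact Hp|].
        intros Hsub. apply Hv. exists c. right. apply Hsub. exact Hc.
      - assert (E : forall p, base p \/ S' p -> S' p)
          by (intros p [Hp|Hp]; auto; apply HSS'; left; exact Hp).
        destruct HS' as [H1 [H2 H3]]. split; [|split].
        + intros; right; apply H1; apply E; auto.
        + intros; right; apply H2; apply E; auto.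
        + intros; apply H3; apply E; auto. }
    destruct HA as [H1 [H2 H3]].
    assert (Huniq : forall v r s, S (v, r) -> S (v, s) -> r <= s).
    { intros v r s Hr Hs. pose proof (H3 _ _ (H1 _ _ _ _ Hr (H2 (-1) _ _ Hs))) as H.
      replace (v +v (-1) *v v) with (0v : X) in H by vlin. rewrite vnorm_0 in H. lra. }
    set (f := fun v => proj1_sig (constructive_indefinite_description _ (Hdom v))).
    assert (Hf : forall v, S (v, f v))
      by (intros v; exact (proj2_sig (constructive_indefinite_description _ (Hdom v)))).
    assert (Hfu : forall v r, S (v, r) -> f v = r) by
      (intros v r Hr; apply Rle_antisym; apply (Huniq v); auto).
    assert (Hs : forall a x, f (a *v x) = a * f x) by (intros; apply Hfu; auto).
    exists f. split; [split; auto|split].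
    + intros x. apply Rabs_le. split.
      * pose proof (H3 _ _ (Hf ((-1) *v x))) as H.
        rewrite Hs, vnorm_scal, Rabs_m1 in H. lra.
      * auto.
    + apply Hfu. left. exists 1. f_equal; [vlin|ring].
Qed.

Lemma linear_form_bounded (X : NormedSpace) (f : X -> R) (C : R) :
  linear_form f -> (forall x, Rabs (f x) <= C * vnorm x) -> bounded_functional f.
Proof. intros [H1 H2] H. split; [|split]; trivial. exists C; trivial. Qed.

(** * Sequences *)

Lemma Un_cv_const (c : R) : Un_cv (fun _ => c) c.
Proof. intros e He. exists 0%nat. intros. rewrite R_dist_eq. lra. Qed.

Lemma Un_cv_ext (u v : nat -> R) (l : R) :
  (forall n, u n = v n) -> Un_cv u l -> Un_cv v l.
Proof. intros H Hu e He. destruct (Hu e He) as [n0 Hn]. exists n0. intros. rewrite <- H; auto. Qed.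

Lemma Un_cv_sub (u : nat -> R) (l : R) (p : nat -> nat) :
  (forall n, (n <= p n)%nat) -> Un_cv u l -> Un_cv (fun n => u (p n)) l.
Proof.
  intros Hp Hu e He. destruct (Hu e He) as [n0 Hn]. exists n0. intros n H. apply Hn.
  specialize (Hp n). lia.
Qed.

Lemma Un_cv_inv_S : Un_cv (fun n => / (INR n + 1)) 0.
Proof.
  intros e He. destruct (archimed_cor1 e He) as [n0 [H1 H2]]. exists n0. intros n Hn.
  unfold R_dist. rewrite Rminus_0_r, Rabs_pos_eq.
  - apply Rle_lt_trans with (/ INR n0); trivial. apply Rinv_le_contravar.
    + apply lt_0_INR; trivial.
    + apply le_INR in Hn. lra.
  - left. apply Rinv_0_lt_compat. pose proof (pos_INR n). lra.
Qed.

Lemma Un_cv_le (u v : nat -> R) (l m : R) :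
  (forall n, u n <= v n) -> Un_cv u l -> Un_cv v m -> l <= m.
Proof. intros. eapply Rle_cv_lim; eauto. Qed.

(** Monotonicity of the extraction is dropped: [n <= p n] suffices to transfer limits, and it
    survives composition. *)
Lemma bounded_subsequence (u : nat -> R) (M : R) :
  (forall n, Rabs (u n) <= M) ->
  exists (p : nat -> nat) (l : R), (forall n, (n <= p n)%nat) /\ Un_cv (fun n => u (p n)) l.
Proof.
  intros Hu.
  destruct (Bolzano_Weierstrass u _ (compact_P3 (- M) M)) as [l Hl].
  { intros n. specialize (Hu n). pose proof (RRle_abs (u n)).
    pose proof (RRle_abs (- u n)) as H'. rewrite Rabs_Ropp in H'. lra. }
  assert (H : forall n, exists q, (n <= q)%nat /\ Rabs (u q - l) < / (INR n + 1)).
  { intros n.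
    assert (Hd : 0 < / (INR n + 1)) by
      (apply Rinv_0_lt_compat; pose proof (pos_INR n); lra).
    destruct (Hl (disc l (mkposreal _ Hd)) n) as [q [H1 H2]].
    - exists (mkposreal _ Hd). intros y Hy; exact Hy.
    - exists q; split; trivial. }
  set (p := fun n => proj1_sig (constructive_indefinite_description _ (H n))).
  assert (Hp : forall n, (n <= p n)%nat /\ Rabs (u (p n) - l) < / (INR n + 1))
    by (intros n; exact (proj2_sig (constructive_indefinite_description _ (H n)))).
  exists p, l. split; [intros n; apply Hp|].
  intros e He. destruct (Un_cv_inv_S e He) as [n0 Hn]. exists n0. intros n Hnn.
  apply Rlt_trans with (/ (INR n + 1)); [apply Hp|].
  specialize (Hn n Hnn). unfold R_dist in Hn. rewrite Rminus_0_r in Hn.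
  eapply Rle_lt_trans; [apply RRle_abs|exact Hn].
Qed.

Lemma bounded_subsequence3 (u v w : nat -> R) (M : R) :
  (forall n, Rabs (u n) <= M) -> (forall n, Rabs (v n) <= M) -> (forall n, Rabs (w n) <= M) ->
  exists (p : nat -> nat) (a b c : R), (forall n, (n <= p n)%nat) /\
    Un_cv (fun n => u (p n)) a /\ Un_cv (fun n => v (p n)) b /\ Un_cv (fun n => w (p n)) c.
Proof.
  intros Hu Hv Hw.
  destruct (bounded_subsequence u M Hu) as [p1 [a [Hp1 Ha]]].
  destruct (bounded_subsequence (fun n => v (p1 n)) M) as [p2 [b [Hp2 Hb]]]; auto.
  destruct (bounded_subsequence (fun n => w (p1 (p2 n))) M) as [p3 [c [Hp3 Hc]]]; auto.
  exists (fun n => p1 (p2 (p3 n))), a, b, c. split; [|split; [|split]]; trivial.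
  - intros n. specialize (Hp3 n). specialize (Hp2 (p3 n)). specialize (Hp1 (p2 (p3 n))). lia.
  - apply (Un_cv_sub (fun n => u (p1 n)) a (fun n => p2 (p3 n))); trivial.
    intros n. specialize (Hp3 n). specialize (Hp2 (p3 n)). lia.
  - apply (Un_cv_sub (fun n => v (p1 (p2 n))) b p3); trivial.
Qed.

(** * Isometries and weak limits *)

Lemma isometry_inverse (X : NormedSpace) (T : X -> X) :
  surj_lin_isometry T ->
  exists S : X -> X, surj_lin_isometry S /\ (forall x, S (T x) = x) /\ (forall x, T (S x) = x).
Proof.
  intros [[HA HS] [Hsurj HN]].
  set (S := fun y => proj1_sig (constructive_indefinite_description _ (Hsurj y))).
  assert (HTS : forall y, T (S y) = y)
    by (intros y; exact (proj2_sig (constructive_indefinite_description _ (Hsurj y)))).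
  assert (Hinj : forall x y, T x = T y -> x = y).
  { intros x y E. apply vsub_eq0, vnorm_eq0. rewrite <- HN. unfold vsub.
    rewrite vopp_scal, HA, HS, E. replace (T y +v (-1) *v T y) with (0v : X) by vlin.
    apply vnorm_0. }
  exists S. split; [split; [split|split]|split]; trivial.
  - intros x y. apply Hinj. rewrite HA, !HTS. reflexivity.
  - intros a x. apply Hinj. rewrite HS, !HTS. reflexivity.
  - intros y. exists (T y). apply Hinj. apply HTS.
  - intros x. rewrite <- (HTS x) at 2. rewrite HN. reflexivity.
  - intros x. apply Hinj, HTS.
Qed.

Lemma isometry_comp (X : NormedSpace) (S T : X -> X) :
  surj_lin_isometry S -> surj_lin_isometry T -> surj_lin_isometry (fun x => S (T x)).
Proof.
  intros [[SA SS] [Ssurj SN]] [[TA TS] [Tsurj TN]]. split; [split|split].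
  - intros; rewrite TA, SA; reflexivity.
  - intros; rewrite TS, SS; reflexivity.
  - intros y. destruct (Ssurj y) as [z <-]. destruct (Tsurj z) as [x <-]. exists x; trivial.
  - intros; rewrite SN, TN; reflexivity.
Qed.

(** The total weight is left free instead of being 1, so that the bound passes to the tail of the
    list. *)
Lemma comb_shift_bound (X : NormedSpace) (x : X) (c : R) (l : list (R * X)) :
  (forall p, In p l -> 0 <= fst p /\ vnorm (x +v snd p) <= c) ->
  vnorm (fold_right Rplus 0 (map fst l) *v x +v comb l) <= fold_right Rplus 0 (map fst l) * c.
Proof.
  induction l as [|[a z] l IH]; intros H; simpl.
  - replace (0 *v x +v 0v) with (0v : X) by vlin. rewrite vnorm_0. lra.
  - set (s := fold_right Rplus 0 (map fst l)) in *.
    assert (IH' : vnorm (s *v x +v comb l) <= s * c) by (apply IH; intros; apply H; right; trivial).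
    destruct (H (a, z)) as [Ha Hz]; [left; trivial|]. simpl in Ha, Hz.
    replace ((a + s) *v x +v (a *v z +v comb l))
      with (a *v (x +v z) +v (s *v x +v comb l)) by vlin.
    eapply Rle_trans; [apply vnorm_triangle|].
    rewrite vnorm_scal, Rabs_pos_eq by trivial.
    apply (Rmult_le_compat_l a) in Hz; trivial. lra.
Qed.

Definition approaches {X : NormedSpace} (v x : X) : Prop :=
  forall d, 0 < d -> exists T, surj_lin_isometry T /\ 2 - d < vnorm (x +v T v).

(** If every [vnorm (x +v T u)] were at most [2 - d], convexity would extend this bound to convex
    combinations of the orbit; but one of them is within [d] of [x], and [2 *v x] has norm 2. *)
Lemma big_point_approaches (X : NormedSpace) (u x : X) :
  big_point u -> vnorm x = 1 -> approaches u x.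
Proof.
  intros [_ Hu] Hx d Hd. apply NNPP. intros Hno.
  destruct (proj2 (Hu x) (Req_le _ _ Hx) d Hd) as [a [[l [Hl [Hsum ->]]] Ha]].
  assert (H : vnorm (1 *v x +v comb l) <= 1 * (2 - d)).
  { rewrite <- Hsum. apply comb_shift_bound. intros p Hp.
    destruct (Hl p Hp) as [H0 [T [HT <-]]]. split; trivial.
    apply Rnot_lt_le. intros HH. apply Hno. exists T; auto. }
  pose proof (vnorm_triangle X (1 *v x +v comb l) (x -v comb l)) as HH.
  replace (1 *v x +v comb l +v (x -v comb l)) with (2 *v x) in HH by vlin.
  rewrite vnorm_scal, Hx, Rabs_pos_eq in HH by lra. lra.
Qed.

(* [vnorm (x + T v) = vnorm (T^-1 x + v)], so the weak LUR property applies at both [x] and [v]. *)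
Lemma approaches_weak (X : NormedSpace) (v x : X) :
  omega_LUR X -> vnorm v = 1 -> vnorm x = 1 -> approaches v x ->
  exists T S : nat -> X -> X,
    (forall n, surj_lin_isometry (T n)) /\ (forall n, surj_lin_isometry (S n)) /\
    (forall n y, S n (T n y) = y) /\ (forall n y, T n (S n y) = y) /\
    weak_cv (fun n => T n v) x /\ weak_cv (fun n => S n x) v.
Proof.
  intros HL Hv Hx H.
  assert (Hn : forall n : nat, exists TS : (X -> X) * (X -> X),
    surj_lin_isometry (fst TS) /\ surj_lin_isometry (snd TS) /\
    (forall y, snd TS (fst TS y) = y) /\ (forall y, fst TS (snd TS y) = y) /\
    2 - / (INR n + 1) < vnorm (x +v fst TS v)).
  { intros n. destruct (H (/ (INR n + 1))) as [T [HT Hd]].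
    - apply Rinv_0_lt_compat. pose proof (pos_INR n). lra.
    - destruct (isometry_inverse X T HT) as [S [HS [H1 H2]]]. exists (T, S); simpl; auto. }
  set (TS := fun n => proj1_sig (constructive_indefinite_description _ (Hn n))).
  assert (HTS := fun n => proj2_sig (constructive_indefinite_description _ (Hn n))).
  change (forall n : nat, surj_lin_isometry (fst (TS n)) /\ surj_lin_isometry (snd (TS n)) /\
    (forall y, snd (TS n) (fst (TS n) y) = y) /\ (forall y, fst (TS n) (snd (TS n) y) = y) /\
    2 - / (INR n + 1) < vnorm (x +v fst (TS n) v)) in HTS.
  clearbody TS.
  assert (NT : forall n y, vnorm (fst (TS n) y) = vnorm y) by (intros n; apply HTS).
  assert (NS : forall n y, vnorm (snd (TS n) y) = vnorm y)
    by (intros n; apply (proj1 (proj2 (HTS n)))).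
  assert (Hcv : Un_cv (fun n => vnorm (x +v fst (TS n) v)) 2).
  { intros e He. destruct (Un_cv_inv_S e He) as [n0 H0]. exists n0. intros n Hnn.
    specialize (H0 n Hnn). unfold R_dist in *. rewrite Rminus_0_r in H0.
    pose proof (RRle_abs (/ (INR n + 1))).
    destruct (HTS n) as [_ [_ [_ [_ H5]]]].
    pose proof (vnorm_triangle X x (fst (TS n) v)) as H6. rewrite NT, Hx, Hv in H6.
    apply Rabs_def1; lra. }
  exists (fun n => fst (TS n)), (fun n => snd (TS n)).
  split; [|split; [|split; [|split; [|split]]]]; try (intros n; apply HTS).
  - apply (HL x Hx); trivial. intros n. rewrite NT, Hv. lra.
  - apply (HL v Hv); [intros n; rewrite NS, Hx; lra|].
    apply Un_cv_ext with (2 := Hcv). intros n.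
    destruct (HTS n) as [[[TA TS'] _] [_ [_ [H4 _]]]].
    rewrite <- (NT n (v +v snd (TS n) x)), TA, H4. f_equal. vlin.
Qed.

(** A sum of norm close to 2 is detected by one functional, hence survives weak limits. The
    isometries [S n] carry [v] weakly to [u], and some [Q] aligns [u] with [x]; a functional norming
    [Q^-1 x + u] still exceeds [2 - d] once [u] is replaced by [S n v] with [n] large. *)
Lemma approaches_all (X : NormedSpace) (u v x : X) :
  omega_LUR X -> big_point u -> vnorm v = 1 -> vnorm x = 1 -> approaches v x.
Proof.
  intros HL Hu Hv Hx d Hd.
  destruct (approaches_weak X u v HL (proj1 Hu) Hv (big_point_approaches X u v Hu Hv))
    as [T [S [_ [HS [_ [_ [_ Hw]]]]]]].
  destruct (big_point_approaches X u x Hu Hx (d / 2)) as [Q [HQ HQd]]; [lra|].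
  destruct (isometry_inverse X Q HQ) as [Q' [HQ' [H1 H2]]].
  destruct (norming_functional X (Q' x +v u)) as [f [Hf [Hfb Hfn]]].
  assert (Hfn' : 2 - d / 2 < f (Q' x) + f u).
  { rewrite <- (proj1 Hf), Hfn. rewrite <- (proj2 (proj2 HQ)), (proj1 (proj1 HQ)), H2. trivial. }
  destruct (Hw f) with (eps := d / 2) as [n0 Hn0].
  - apply (linear_form_bounded X f 1 Hf). intros y. rewrite Rmult_1_l; trivial.
  - lra.
  - specialize (Hn0 n0 (le_n n0)). apply Rabs_def2 in Hn0.
    exists (fun y => Q (S n0 y)). split; [apply isometry_comp; trivial|].
    rewrite <- (H2 x), <- (proj1 (proj1 HQ)), (proj2 (proj2 HQ)).
    pose proof (Hfb (Q' x +v S n0 v)) as H3. rewrite (proj1 Hf) in H3.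
    pose proof (RRle_abs (f (Q' x) + f (S n0 v))). lra.
Qed.

(** The weak LUR property at [x] applies to the constant sequence [z], and functionals separate
    points. *)
Lemma omega_LUR_rotund (X : NormedSpace) (x z : X) :
  omega_LUR X -> vnorm x = 1 -> vnorm z = 1 -> 2 <= vnorm (x +v z) -> x = z.
Proof.
  intros HL Hx Hz H. apply vsub_eq0, vnorm_eq0.
  destruct (norming_functional X (x -v z)) as [f [Hf [Hfb <-]]].
  assert (Hw : weak_cv (fun _ => z) x).
  { apply (HL x Hx); [intros; lra|].
    pose proof (vnorm_triangle X x z). replace 2 with (vnorm (x +v z)) by lra.
    apply Un_cv_const. }
  assert (E : f x = f z).
  { apply (UL_sequence (fun _ => f z)); [|apply Un_cv_const]. apply Hw.
    apply (linear_form_bounded X f 1 Hf). intros y. rewrite Rmult_1_l; trivial. }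
  unfold vsub. rewrite vopp_scal, (proj1 Hf), (proj2 Hf), E. ring.
Qed.

(** * Nearest points on lines *)

(** Since [Z] has codimension 1 and is fixed by [P], all vectors [x - P x] lie on one line. A unit
    vector [v] of that line and the coefficient [f] along it give [P x = x - f(x) v]. *)
Lemma projection_functional (X : NormedSpace) (Z : X -> Prop) (P : X -> X) (c : R) :
  codim1 Z -> lin_projection_onto Z P -> op_norm_le P c ->
  exists (f : X -> R) (v : X), linear_form f /\ vnorm v = 1 /\ f v = 1 /\
    (forall x, vnorm (x -v f x *v v) <= c * vnorm x).
Proof.
  intros [v0 [Hv0 Hdec]] [[PA PS] [PZ PI]] HP.
  assert (Pv0 : v0 -v P v0 <> 0v).
  { intros E. apply Hv0. rewrite (vsub_eq0 X _ _ E). apply PZ. }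
  pose proof (vnorm_gt0 X _ Pv0) as Hpos.
  set (v := / vnorm (v0 -v P v0) *v (v0 -v P v0)).
  assert (Hv : vnorm v = 1).
  { unfold v. rewrite vnorm_scal, Rabs_pos_eq.
    - field. lra.
    - left; apply Rinv_0_lt_compat; trivial. }
  assert (Hex : forall x, exists t, x -v P x = t *v v).
  { intros x. destruct (Hdec x) as [z [t [Hz ->]]].
    exists (t * vnorm (v0 -v P v0)). unfold v. rewrite PA, PS, (PI z Hz). vlin. }
  set (f := fun x => proj1_sig (constructive_indefinite_description _ (Hex x))).
  assert (Hf : forall x, x -v P x = f x *v v)
    by (intros x; exact (proj2_sig (constructive_indefinite_description _ (Hex x)))).
  assert (Hu : forall a b, a *v v = b *v v -> a = b).
  { intros a b E. assert (H : vnorm ((a - b) *v v) = 0).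
    { replace ((a - b) *v v) with (a *v v -v b *v v) by vlin. rewrite E.
      replace (b *v v -v b *v v) with (0v : X) by vlin. apply vnorm_0. }
    rewrite vnorm_scal, Hv, Rmult_1_r in H. 
    destruct (Req_dec (a - b) 0) as [|Hab]; [lra|]. elim (Rabs_no_R0 _ Hab H). }
  assert (Pv : P v = 0v).
  { unfold v, vsub. rewrite PS, vopp_scal, PA, PS, (PI (P v0) (PZ v0)). vlin. }
  exists f, v. split; [split|split; [|split]]; trivial.
  - intros x y. apply Hu. rewrite vscal_distr_r, <- !Hf, PA. vlin.
  - intros a x. apply Hu. rewrite <- vscal_assoc, <- !Hf, PS. vlin.
  - apply Hu. rewrite <- Hf, Pv. vlin.
  - intros x. rewrite <- Hf. replace (x -v (x -v P x)) with (P x) by vlin. apply HP.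
Qed.

(** Conjugation turns the projection into [y -v f (S n y) *v T n v], with the same bound [c]. The
    scalars [f (S n y1)] and [f (S n y2)] converge along a subsequence, and [f (S n x)] tends to
    [f v = 1], so the limit kills [x]: this is why [t] is absent on the left. A functional norming
    the limit vector carries the bound through [T n v -> x]. *)
Lemma weak_projection_limit (X : NormedSpace) (f : X -> R) (v x : X) (c : R)
    (T S : nat -> X -> X) (y1 y2 : X) :
  linear_form f -> vnorm v = 1 -> f v = 1 ->
  (forall y, vnorm (y -v f y *v v) <= c * vnorm y) ->
  (forall n, surj_lin_isometry (T n)) -> (forall n, surj_lin_isometry (S n)) ->
  (forall n y, T n (S n y) = y) ->
  weak_cv (fun n => T n v) x -> weak_cv (fun n => S n x) v ->
  exists g1 g2, forall a b t,
    vnorm (a *v (y1 -v g1 *v x) +v b *v (y2 -v g2 *v x))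
      <= c * vnorm (a *v y1 +v b *v y2 +v t *v x).
Proof.
  intros Hf Hv Hfv HP HT HS HTS Hw Hw'.
  assert (Hfb : forall y, Rabs (f y) <= (1 + c) * vnorm y).
  { intros y. pose proof (HP y). pose proof (vnorm_sub_le X y (y -v f y *v v)) as H1.
    replace (y -v (y -v f y *v v)) with (f y *v v) in H1 by vlin.
    rewrite vnorm_scal, Hv in H1. lra. }
  assert (NS : forall n y, vnorm (S n y) = vnorm y) by (intros n; apply (HS n)).
  set (M := (1 + c) * vnorm y1 + (1 + c) * vnorm y2).
  assert (Hb1 : forall n, Rabs (f (S n y1)) <= M).
  { intros n. pose proof (Hfb (S n y1)) as H. pose proof (Hfb y2).
    pose proof (Rabs_pos (f y2)). rewrite NS in H. unfold M. lra. }
  assert (Hb2 : forall n, Rabs (f (S n y2)) <= M).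
  { intros n. pose proof (Hfb (S n y2)) as H. pose proof (Hfb y1).
    pose proof (Rabs_pos (f y1)). rewrite NS in H. unfold M. lra. }
  destruct (bounded_subsequence3 _ _ _ M Hb1 Hb2 Hb2) as [p [g1 [g2 [_ [Hp [H1 [H2 _]]]]]]].
  exists g1, g2. intros a b t.
  set (Y := a *v y1 +v b *v y2 +v t *v x).
  set (W := a *v (y1 -v g1 *v x) +v b *v (y2 -v g2 *v x)).
  destruct (norming_functional X W) as [h [Hh [Hhb <-]]].
  assert (Hfx : Un_cv (fun n => f (S (p n) x)) 1).
  { rewrite <- Hfv. apply (Un_cv_sub (fun n => f (S n x)) (f v) p Hp).
    apply Hw'. apply (linear_form_bounded X f (1 + c) Hf Hfb). }
  assert (Hhx : Un_cv (fun n => h (T (p n) v)) (h x)).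
  { apply (Un_cv_sub (fun n => h (T n v)) (h x) p Hp).
    apply Hw. apply (linear_form_bounded X h 1 Hh). intros y. rewrite Rmult_1_l; trivial. }
  assert (HfY : Un_cv (fun n => f (S (p n) Y)) (a * g1 + b * g2 + t * 1)).
  { apply Un_cv_ext with (fun n => a * f (S (p n) y1) + b * f (S (p n) y2) + t * f (S (p n) x)).
    - intros n. unfold Y. destruct (HS (p n)) as [[SA SS] _].
      rewrite !SA, !SS, !(proj1 Hf), !(proj2 Hf). ring.
    - apply CV_plus; [apply CV_plus|]; apply CV_mult; trivial; apply Un_cv_const. }
  apply Un_cv_le with (fun n => h Y - f (S (p n) Y) * h (T (p n) v)) (fun _ => c * vnorm Y).
  - intros n. destruct (HT (p n)) as [[TA TS] [_ TN]].
    apply Rle_trans with (vnorm (T (p n) (S (p n) Y -v f (S (p n) Y) *v v))).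
    + eapply Rle_trans; [|apply Hhb]. eapply Rle_trans; [|apply RRle_abs].
      apply Req_le. unfold vsub. rewrite vopp_scal, TA, !TS, HTS, (proj1 Hh), !(proj2 Hh). ring.
    + rewrite TN. eapply Rle_trans; [apply HP|]. rewrite NS. lra.
  - replace (h W) with (h Y - (a * g1 + b * g2 + t * 1) * h x).
    + apply CV_minus; [apply Un_cv_const|]. apply CV_mult; trivial.
    + unfold W, Y, vsub. rewrite !vopp_scal.
      repeat rewrite ?(proj1 Hh), ?(proj2 Hh). ring.
  - apply Un_cv_const.
Qed.

Lemma vnorm_combine_le (X : NormedSpace) (a b : R) (x y : X) :
  vnorm (a *v x +v b *v y) <= Rabs a * vnorm x + Rabs b * vnorm y.
Proof. rewrite <- !vnorm_scal. apply vnorm_triangle. Qed.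

Lemma vnorm_affine_cv (X : NormedSpace) (z x y : X) (a b : nat -> R) (la lb : R) :
  Un_cv a la -> Un_cv b lb ->
  Un_cv (fun n => vnorm (z +v a n *v x +v b n *v y)) (vnorm (z +v la *v x +v lb *v y)).
Proof.
  intros Ha Hb e He.
  set (C := vnorm x + vnorm y + 1).
  pose proof (vnorm_ge0 X x). pose proof (vnorm_ge0 X y).
  assert (HC : 0 < C) by (unfold C; lra).
  assert (HeC : 0 < e / C) by (apply Rdiv_lt_0_compat; trivial).
  destruct (Ha _ HeC) as [n1 H1]. destruct (Hb _ HeC) as [n2 H2].
  exists (n1 + n2)%nat. intros n Hn.
  specialize (H1 n ltac:(lia)). specialize (H2 n ltac:(lia)). unfold R_dist in *.
  assert (HD : vnorm ((a n - la) *v x +v (b n - lb) *v y) < e).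
  { eapply Rle_lt_trans; [apply vnorm_combine_le|].
    apply Rle_lt_trans with (e / C * vnorm x + e / C * vnorm y).
    - apply Rplus_le_compat; apply Rmult_le_compat_r; lra.
    - assert (E : e / C * (vnorm x + vnorm y + 1) = e) by (fold C; field; lra).
      rewrite !Rmult_plus_distr_l in E. lra. }
  pose proof (vnorm_sub_ge X (z +v a n *v x +v b n *v y) (z +v la *v x +v lb *v y)) as HA.
  pose proof (vnorm_sub_ge X (z +v la *v x +v lb *v y) (z +v a n *v x +v b n *v y)) as HB.
  replace (z +v a n *v x +v b n *v y -v (z +v la *v x +v lb *v y))
    with ((a n - la) *v x +v (b n - lb) *v y) in HA by vlin.
  replace (z +v la *v x +v lb *v y -v (z +v a n *v x +v b n *v y))
    with (vopp ((a n - la) *v x +v (b n - lb) *v y)) in HB by vlin.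
  rewrite vnorm_opp in HB. apply Rabs_def1; lra.
Qed.

(** Norm-one projections along [x], recorded on two vectors at a time because a subsequence makes
    only finitely many scalars converge. The coefficients may depend on the pair; rotundity will
    make them unique, and so linear. *)
Definition linear_projections (X : NormedSpace) : Prop :=
  forall x y1 y2 : X, x <> 0v -> exists g1 g2, forall a b t,
    vnorm (a *v (y1 -v g1 *v x) +v b *v (y2 -v g2 *v x))
      <= vnorm (a *v y1 +v b *v y2 +v t *v x).

Lemma near_projections_limit (X : NormedSpace) :
  (forall (x y1 y2 : X) (eps : R), vnorm x = 1 -> 0 < eps -> exists g1 g2, forall a b t,
    vnorm (a *v (y1 -v g1 *v x) +v b *v (y2 -v g2 *v x))
      <= (1 + eps) * vnorm (a *v y1 +v b *v y2 +v t *v x)) ->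
  linear_projections X.
Proof.
  intros H x' y1 y2 Hx'.
  pose proof (vnorm_gt0 X _ Hx') as Hpos.
  set (x := / vnorm x' *v x').
  assert (Hx : vnorm x = 1).
  { unfold x. rewrite vnorm_scal, Rabs_pos_eq.
    - field; lra.
    - left; apply Rinv_0_lt_compat; trivial. }
  assert (Hd : forall n : nat, 0 < / (INR n + 1) <= 1).
  { intros n. pose proof (pos_INR n). split.
    - apply Rinv_0_lt_compat; lra.
    - rewrite <- Rinv_1 at 2. apply Rinv_le_contravar; lra. }
  assert (Hn : forall n : nat, exists g : R * R, forall a b t,
    vnorm (a *v (y1 -v fst g *v x) +v b *v (y2 -v snd g *v x))
      <= (1 + / (INR n + 1)) * vnorm (a *v y1 +v b *v y2 +v t *v x)).
  { intros n. destruct (H x y1 y2 _ Hx (proj1 (Hd n))) as [g1 [g2 Hg]].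
    exists (g1, g2); exact Hg. }
  destruct (ClassicalEpsilon.choice _ Hn) as [g Hg]. clear Hn.
  (* Each [eps] used is at most 1, so a projected [y1] has norm at most [2 * vnorm y1], and it
     differs from [y1] by a multiple of the unit vector [x] of norm at most [3 * vnorm y1]; likewise
     for [y2]. *)
  set (M := 3 * vnorm y1 + 3 * vnorm y2).
  pose proof (vnorm_ge0 X y1) as N1. pose proof (vnorm_ge0 X y2) as N2.
  assert (Hb1 : forall n, Rabs (fst (g n)) <= M).
  { intros n. pose proof (Hg n 1 0 0) as E. pose proof (Hd n).
    replace (1 *v y1 +v 0 *v y2 +v 0 *v x) with y1 in E by vlin.
    replace (1 *v (y1 -v fst (g n) *v x) +v 0 *v (y2 -v snd (g n) *v x))
      with (y1 -v fst (g n) *v x) in E by vlin.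
    pose proof (vnorm_sub_le X y1 (y1 -v fst (g n) *v x)) as H1.
    replace (y1 -v (y1 -v fst (g n) *v x)) with (fst (g n) *v x) in H1 by vlin.
    rewrite vnorm_scal, Hx in H1. unfold M.
    assert ((1 + / (INR n + 1)) * vnorm y1 <= 2 * vnorm y1)
      by (apply Rmult_le_compat_r; lra). lra. }
  assert (Hb2 : forall n, Rabs (snd (g n)) <= M).
  { intros n. pose proof (Hg n 0 1 0) as E. pose proof (Hd n).
    replace (0 *v y1 +v 1 *v y2 +v 0 *v x) with y2 in E by vlin.
    replace (0 *v (y1 -v fst (g n) *v x) +v 1 *v (y2 -v snd (g n) *v x))
      with (y2 -v snd (g n) *v x) in E by vlin.
    pose proof (vnorm_sub_le X y2 (y2 -v snd (g n) *v x)) as H1.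
    replace (y2 -v (y2 -v snd (g n) *v x)) with (snd (g n) *v x) in H1 by vlin.
    rewrite vnorm_scal, Hx in H1. unfold M.
    assert ((1 + / (INR n + 1)) * vnorm y2 <= 2 * vnorm y2)
      by (apply Rmult_le_compat_r; lra). lra. }
  destruct (bounded_subsequence3 _ _ _ M Hb1 Hb2 Hb2) as [p [g1 [g2 [_ [Hp [H1 [H2 _]]]]]]].
  exists (g1 / vnorm x'), (g2 / vnorm x'). intros a b t.
  set (t' := t * vnorm x').
  replace (a *v y1 +v b *v y2 +v t *v x') with (a *v y1 +v b *v y2 +v t' *v x)
    by (unfold t', x; vlin).
  apply Un_cv_le with
    (fun n => vnorm (a *v y1 +v b *v y2 +v (- a * fst (g (p n))) *v x
                     +v (- b * snd (g (p n))) *v x))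
    (fun n => (1 + / (INR (p n) + 1)) * vnorm (a *v y1 +v b *v y2 +v t' *v x)).
  - intros n. eapply Rle_trans; [|apply Hg]. apply Req_le. f_equal. vlin.
  - replace (vnorm (a *v (y1 -v (g1 / vnorm x') *v x') +v b *v (y2 -v (g2 / vnorm x') *v x')))
      with (vnorm (a *v y1 +v b *v y2 +v (- a * g1) *v x +v (- b * g2) *v x))
      by (f_equal; unfold x; vlin).
    apply vnorm_affine_cv; apply CV_mult; trivial; apply Un_cv_const.
  - replace (vnorm (a *v y1 +v b *v y2 +v t' *v x))
      with ((1 + 0) * vnorm (a *v y1 +v b *v y2 +v t' *v x)) at 1 by ring.
    apply CV_mult; [|apply Un_cv_const]. apply CV_plus; [apply Un_cv_const|].
    apply (Un_cv_sub _ _ p Hp Un_cv_inv_S).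
Qed.

(** * Rotundity and best approximation *)

Definition rotund (X : NormedSpace) : Prop :=
  forall p q : X, vnorm p = vnorm q -> vnorm p <= vnorm (/ 2 *v (p +v q)) -> p = q.

Lemma omega_LUR_imp_rotund (X : NormedSpace) : omega_LUR X -> rotund X.
Proof.
  intros HL p q E H.
  destruct (classic (p = 0v)) as [->|Hp].
  - symmetry. apply vnorm_eq0. rewrite <- E. apply vnorm_0.
  - pose proof (vnorm_gt0 X p Hp) as Hpos. set (r := vnorm p) in *.
    assert (Hr : 0 < / r) by (apply Rinv_0_lt_compat; trivial).
    assert (Hpq : / r *v p = / r *v q).
    { apply omega_LUR_rotund; trivial.
      - rewrite vnorm_scal, Rabs_pos_eq by lra. fold r. field; lra.
      - rewrite vnorm_scal, Rabs_pos_eq, <- E by lra. field; lra.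
      - replace (/ r *v p +v / r *v q) with ((2 * / r) *v (/ 2 *v (p +v q))) by vlin.
        rewrite vnorm_scal, Rabs_pos_eq by lra.
        apply (Rmult_le_compat_l (2 * / r)) in H; [|lra].
        replace (2 * / r * r) with 2 in H by (field; lra). exact H. }
    replace p with (r *v (/ r *v p)) by vlin. rewrite Hpq. vlin.
Qed.

(** All that is retained of [X] in dimension at least 3; the isometries return only for planes. *)
Definition rotund_with_projections (X : NormedSpace) : Prop := rotund X /\ linear_projections X.

(** The form [g_x] of the overview, made total by a choice operator; its value is meaningless at
    [x = 0v]. *)
Definition nearest {X : NormedSpace} (x y : X) : R :=
  epsilon (inhabits 0) (fun t => forall s, vnorm (y -v t *v x) <= vnorm (y -v s *v x)).

Lemma nearest_min (X : NormedSpace) (x y : X) (s : R) :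
  rotund_with_projections X -> x <> 0v ->
  vnorm (y -v nearest x y *v x) <= vnorm (y -v s *v x).
Proof.
  intros [_ HP] Hx. revert s. unfold nearest. apply epsilon_spec.
  destruct (HP x y y Hx) as [g1 [g2 Hg]]. exists g1. intros s.
  replace (y -v g1 *v x) with (1 *v (y -v g1 *v x) +v 0 *v (y -v g2 *v x)) by vlin.
  replace (y -v s *v x) with (1 *v y +v 0 *v y +v (- s) *v x) by vlin. apply Hg.
Qed.

Lemma vscal_eq0 (X : NormedSpace) (a : R) (x : X) : x <> 0v -> a *v x = 0v -> a = 0.
Proof.
  intros Hx E. destruct (Req_dec a 0) as [|Ha]; trivial. elim Hx.
  replace x with (/ a *v (a *v x)) by vlin. rewrite E. apply vscal_0r.
Qed.

(** The midpoint of two nearest points lies on the same line, so rotundity identifies them. *)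
Lemma nearest_unique (X : NormedSpace) (x y : X) (t : R) :
  rotund_with_projections X -> x <> 0v ->
  (forall s, vnorm (y -v t *v x) <= vnorm (y -v s *v x)) -> nearest x y = t.
Proof.
  intros HX Hx Ht. pose proof (fun s => nearest_min X x y s HX Hx) as Hn.
  set (r := nearest x y) in *.
  assert (E : y -v r *v x = y -v t *v x).
  { apply (proj1 HX).
    - apply Rle_antisym; auto.
    - replace (/ 2 *v (y -v r *v x +v (y -v t *v x))) with (y -v ((r + t) / 2) *v x) by vlin.
      auto. }
  assert (E0 : (r - t) *v x = 0v).
  { replace ((r - t) *v x) with ((y -v t *v x) -v (y -v r *v x)) by vlin. rewrite E. vlin. }
  apply vscal_eq0 in E0; trivial. lra.
Qed.

(** One pair of coefficients serves all combinations of [y1] and [y2] at once; uniqueness identifies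
    these coefficients with the values of [nearest x]. *)
Lemma nearest_linear (X : NormedSpace) (x : X) :
  rotund_with_projections X -> x <> 0v -> linear_form (nearest x).
Proof.
  intros HX Hx.
  assert (H : forall a b y1 y2,
    nearest x (a *v y1 +v b *v y2) = a * nearest x y1 + b * nearest x y2).
  { intros a b y1 y2. destruct (proj2 HX x y1 y2 Hx) as [g1 [g2 Hg]].
    assert (E1 : nearest x y1 = g1).
    { apply nearest_unique; trivial. intros s.
      replace (y1 -v g1 *v x) with (1 *v (y1 -v g1 *v x) +v 0 *v (y2 -v g2 *v x)) by vlin.
      replace (y1 -v s *v x) with (1 *v y1 +v 0 *v y2 +v (- s) *v x) by vlin. apply Hg. }
    assert (E2 : nearest x y2 = g2).
    { apply nearest_unique; trivial. intros s.
      replace (y2 -v g2 *v x) with (0 *v (y1 -v g1 *v x) +v 1 *v (y2 -v g2 *v x)) by vlin.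
      replace (y2 -v s *v x) with (0 *v y1 +v 1 *v y2 +v (- s) *v x) by vlin. apply Hg. }
    rewrite E1, E2. apply nearest_unique; trivial. intros s.
    replace (a *v y1 +v b *v y2 -v (a * g1 + b * g2) *v x)
      with (a *v (y1 -v g1 *v x) +v b *v (y2 -v g2 *v x)) by vlin.
    replace (a *v y1 +v b *v y2 -v s *v x) with (a *v y1 +v b *v y2 +v (- s) *v x) by vlin.
    apply Hg. }
  split.
  - intros y1 y2. replace (y1 +v y2) with (1 *v y1 +v 1 *v y2) by vlin. rewrite H. ring.
  - intros a y. replace (a *v y) with (a *v y +v 0 *v y) by vlin. rewrite H. ring.
Qed.

Lemma nearest_self (X : NormedSpace) (x : X) :
  rotund_with_projections X -> x <> 0v -> nearest x x = 1.
Proof.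
  intros HX Hx. apply nearest_unique; trivial. intros s.
  replace (x -v 1 *v x) with (0v : X) by vlin. rewrite vnorm_0. apply vnorm_ge0.
Qed.

(** The right side is Birkhoff orthogonality of [y] to [x]: linear in [y] by [nearest_linear], but
    so far neither additive in [x] nor symmetric. *)
Lemma nearest_eq0 (X : NormedSpace) (x y : X) :
  rotund_with_projections X -> x <> 0v ->
  nearest x y = 0 <-> (forall s, vnorm y <= vnorm (y +v s *v x)).
Proof.
  intros HX Hx. split.
  - intros E s. pose proof (nearest_min X x y (- s) HX Hx) as H. rewrite E in H.
    replace (y -v 0 *v x) with y in H by vlin.
    replace (y -v - s *v x) with (y +v s *v x) in H by vlin. exact H.
  - intros H. apply nearest_unique; trivial. intros s.
    replace (y -v 0 *v x) with y by vlin.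
    replace (y -v s *v x) with (y +v (- s) *v x) by vlin. apply H.
Qed.

Lemma nearest_scal_eq0 (X : NormedSpace) (c : R) (x y : X) :
  rotund_with_projections X -> x <> 0v -> c <> 0 ->
  nearest (c *v x) y = 0 <-> nearest x y = 0.
Proof.
  intros HX Hx Hc.
  assert (Hcx : c *v x <> 0v) by (intros E; apply Hc; apply (vscal_eq0 X c x Hx E)).
  rewrite !nearest_eq0 by trivial. split; intros H s.
  - replace (s *v x) with ((s / c) *v (c *v x)) by vlin. apply H.
  - rewrite vscal_assoc. apply H.
Qed.

Lemma nearest_bound (X : NormedSpace) (x y : X) :
  rotund_with_projections X -> x <> 0v -> Rabs (nearest x y) * vnorm x <= 2 * vnorm y.
Proof.
  intros HX Hx. rewrite <- vnorm_scal.
  pose proof (nearest_min X x y 0 HX Hx) as H. replace (y -v 0 *v x) with y in H by vlin.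
  pose proof (vnorm_sub_le X y (y -v nearest x y *v x)) as H1.
  replace (y -v (y -v nearest x y *v x)) with (nearest x y *v x) in H1 by vlin. lra.
Qed.

Definition indep2 {X : NormedSpace} (x y : X) : Prop :=
  forall a b, a *v x +v b *v y = 0v -> a = 0 /\ b = 0.

Definition indep3 {X : NormedSpace} (x y z : X) : Prop :=
  forall a b c, a *v x +v b *v y +v c *v z = 0v -> a = 0 /\ b = 0 /\ c = 0.

(** Both halves of the projection along [x] are bounded. The remainder [b (y - g x)] controls [b],
    and then [nearest x v = a + b g] controls [a]. *)
Lemma coordinates_bounded (X : NormedSpace) (x y : X) :
  rotund_with_projections X -> indep2 x y ->
  exists C, 0 <= C /\
    forall a b, Rabs a <= C * vnorm (a *v x +v b *v y) /\ Rabs b <= C * vnorm (a *v x +v b *v y).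
Proof.
  intros HX Hi.
  assert (Hx : x <> 0v).
  { intros E. destruct (Hi 1 0) as [H _]; [rewrite E; vlin|lra]. }
  pose proof (nearest_linear X x HX Hx) as [GA GS]. pose proof (nearest_self X x HX Hx) as G1.
  set (g := nearest x y) in *.
  assert (Hy' : y -v g *v x <> 0v).
  { intros E. destruct (Hi (- g) 1) as [_ H]; [|lra]. rewrite <- E. vlin. }
  pose proof (vnorm_gt0 X _ Hx) as Nx. pose proof (vnorm_gt0 X _ Hy') as Ny.
  set (m := vnorm (y -v g *v x)) in *.
  assert (Ix : 0 < / vnorm x) by (apply Rinv_0_lt_compat; trivial).
  assert (Im : 0 < / m) by (apply Rinv_0_lt_compat; trivial).
  pose proof (Rabs_pos g) as Hg.
  exists (2 * / vnorm x + (1 + Rabs g) * / m). split.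
  { assert (0 <= (1 + Rabs g) * / m) by (apply Rmult_le_pos; lra). lra. }
  intros a b. set (v := a *v x +v b *v y). pose proof (vnorm_ge0 X v) as Nv.
  assert (Gv : nearest x v = a + b * g).
  { unfold v. rewrite GA, !GS, G1. fold g. ring. }
  assert (Hb : Rabs b <= / m * vnorm v).
  { pose proof (nearest_min X x v 0 HX Hx) as H. rewrite Gv in H.
    replace (v -v 0 *v x) with v in H by vlin.
    replace (v -v (a + b * g) *v x) with (b *v (y -v g *v x)) in H by (unfold v; vlin).
    rewrite vnorm_scal in H. fold m in H.
    apply (Rmult_le_compat_l (/ m)) in H; [|lra].
    replace (/ m * (Rabs b * m)) with (Rabs b) in H by (field; lra). exact H. }
  assert (Ha : Rabs (a + b * g) <= 2 * / vnorm x * vnorm v).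
  { pose proof (nearest_bound X x v HX Hx) as H. rewrite Gv in H.
    apply (Rmult_le_compat_l (/ vnorm x)) in H; [|lra].
    replace (/ vnorm x * (Rabs (a + b * g) * vnorm x)) with (Rabs (a + b * g)) in H by (field; lra).
    lra. }
  assert (Hbg : Rabs (b * g) <= / m * vnorm v * Rabs g).
  { rewrite Rabs_mult. apply Rmult_le_compat_r; trivial. }
  pose proof (Rabs_triang (a + b * g) (- (b * g))) as Ht. rewrite Rabs_Ropp in Ht.
  replace (a + b * g + - (b * g)) with a in Ht by ring.
  assert (0 <= / vnorm x * vnorm v) by (apply Rmult_le_pos; lra).
  assert (0 <= / m * vnorm v) by (apply Rmult_le_pos; lra).
  assert (0 <= / m * vnorm v * Rabs g) by (apply Rmult_le_pos; lra).
  split; lra.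
Qed.

(** Weierstrass in sequential form. Three parameters fit the quadratic forms of the planar case;
    where two are enough, the third is pinned to 0. *)
Lemma compact_argmin (K : R -> R -> R -> Prop) (F : R -> R -> R -> R) (M m : R) :
  (exists a b c, K a b c) ->
  (forall a b c, K a b c -> Rabs a <= M /\ Rabs b <= M /\ Rabs c <= M) ->
  (forall a b c, K a b c -> m <= F a b c) ->
  (forall (a b c : nat -> R) la lb lc, Un_cv a la -> Un_cv b lb -> Un_cv c lc ->
     (forall n, K (a n) (b n) (c n)) ->
     K la lb lc /\ Un_cv (fun n => F (a n) (b n) (c n)) (F la lb lc)) ->
  exists a b c, K a b c /\ forall a' b' c', K a' b' c' -> F a b c <= F a' b' c'.
Proof.
  intros [a0 [b0 [c0 H0]]] Hb Hm Hc.
  destruct (completeness (fun r => exists a b c, K a b c /\ r = - F a b c)) as [i [Hub Hlub]].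
  - exists (- m). intros r [a [b [c [HK ->]]]]. specialize (Hm _ _ _ HK). lra.
  - eexists. exists a0, b0, c0. split; [trivial|reflexivity].
  - assert (Hn : forall n : nat, exists p : R * R * R,
      K (fst (fst p)) (snd (fst p)) (snd p) /\
      F (fst (fst p)) (snd (fst p)) (snd p) <= - i + / (INR n + 1)).
    { intros n. apply NNPP. intros Hno.
      assert (Hd : 0 < / (INR n + 1)) by
        (apply Rinv_0_lt_compat; pose proof (pos_INR n); lra).
      assert (i <= i - / (INR n + 1)); [|lra].
      apply Hlub. intros r [a [b [c [HK ->]]]].
      apply Rnot_lt_le. intros Hlt. apply Hno. exists (a, b, c). simpl. split; [trivial|lra]. }
    destruct (ClassicalEpsilon.choice _ Hn) as [p Hp]. clear Hn.
    destruct (bounded_subsequence3 (fun n => fst (fst (p n))) (fun n => snd (fst (p n)))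
      (fun n => snd (p n)) M) as [q [a [b [c [Hq [Ha [Hb' Hc']]]]]]];
      try (intros n; apply (Hb _ _ _ (proj1 (Hp n)))).
    destruct (Hc _ _ _ _ _ _ Ha Hb' Hc' (fun n => proj1 (Hp (q n)))) as [HK HF].
    exists a, b, c. split; trivial. intros a' b' c' HK'.
    apply Rle_trans with (- i).
    + apply Un_cv_le with (2 := HF) (v := fun n => - i + / (INR (q n) + 1)).
      * intros n. apply Hp.
      * replace (- i) with (- i + 0) at 1 by ring. apply CV_plus; [apply Un_cv_const|].
        apply (Un_cv_sub _ _ q Hq Un_cv_inv_S).
    + assert (- F a' b' c' <= i); [|lra]. apply Hub. exists a', b', c'; auto.
Qed.

(** A vector of least norm in [w + span(x1, x2)] is orthogonal to the whole plane. *)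
Lemma common_perpendicular (X : NormedSpace) (x1 x2 w : X) :
  rotund_with_projections X -> indep2 x1 x2 ->
  exists a b, forall s t, s *v x1 +v t *v x2 <> 0v ->
    nearest (s *v x1 +v t *v x2) (w -v a *v x1 -v b *v x2) = 0.
Proof.
  intros HX Hi. destruct (coordinates_bounded X x1 x2 HX Hi) as [C [HC0 HC]].
  destruct (compact_argmin
    (fun a b c => vnorm (w +v a *v x1 +v b *v x2) <= vnorm w /\ c = 0)
    (fun a b c => vnorm (w +v a *v x1 +v b *v x2)) (C * (2 * vnorm w)) 0)
    as [a [b [c [[Hab _] Hmin]]]].
  - exists 0, 0, 0. split; trivial. replace (w +v 0 *v x1 +v 0 *v x2) with w by vlin. lra.
  - intros a b c [H ->]. pose proof (vnorm_sub_le X (w +v a *v x1 +v b *v x2) w) as H1.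
    replace (w +v a *v x1 +v b *v x2 -v w) with (a *v x1 +v b *v x2) in H1 by vlin.
    pose proof (vnorm_ge0 X w).
    assert (C * vnorm (a *v x1 +v b *v x2) <= C * (2 * vnorm w))
      by (apply Rmult_le_compat_l; lra).
    destruct (HC a b). rewrite Rabs_R0. pose proof (Rabs_pos a). repeat split; lra.
  - intros; apply vnorm_ge0.
  - intros a b c la lb lc Ha Hb Hc HK.
    pose proof (vnorm_affine_cv X w x1 x2 a b la lb Ha Hb) as Hcv.
    split; [split|]; trivial.
    + apply Un_cv_le with (2 := Hcv) (3 := Un_cv_const (vnorm w)). intros n; apply HK.
    + apply (UL_sequence c); trivial.
      apply Un_cv_ext with (2 := Un_cv_const 0). intros n; symmetry; apply HK.
  - exists (- a), (- b). intros s t Hst. apply nearest_eq0; trivial. intros r.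
    replace (w -v - a *v x1 -v - b *v x2) with (w +v a *v x1 +v b *v x2) by vlin.
    replace (w +v a *v x1 +v b *v x2 +v r *v (s *v x1 +v t *v x2))
      with (w +v (a + r * s) *v x1 +v (b + r * t) *v x2) by vlin.
    destruct (Rle_lt_dec (vnorm (w +v (a + r * s) *v x1 +v (b + r * t) *v x2)) (vnorm w)).
    + apply (Hmin _ _ 0). auto.
    + lra.
Qed.

(** * Smoothness *)

Lemma indep3_combine_neq0 (X : NormedSpace) (x y z : X) (a b c : R) :
  indep3 x y z -> (a <> 0 \/ b <> 0 \/ c <> 0) -> a *v x +v b *v y +v c *v z <> 0v.
Proof. intros Hi H E. destruct (Hi _ _ _ E) as [-> [-> ->]]. lra. Qed.

(** Inside the span of [x], [k], [d], the kernel of [nearest z1] is the plane of [k] and [d], which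
    the kernel of [nearest z] meets only in a line. A common perpendicular of [z] and [z1], nonzero
    by independence, lies on that line, so every vector of the line is orthogonal to the plane of
    [z] and [z1]. *)
Lemma plane_perpendicular (X : NormedSpace) (x k d z z1 : X) (z0 zk zd b e1 e2 : R) :
  rotund_with_projections X -> indep3 x k d ->
  z = z0 *v x +v zk *v k +v zd *v d -> z1 = x +v b *v k ->
  indep3 k z z1 ->
  nearest z1 k = 0 -> nearest z1 d = 0 ->
  (nearest z k <> 0 \/ nearest z d <> 0) ->
  nearest z (e1 *v k +v e2 *v d) = 0 ->
  forall s t, s *v z +v t *v z1 <> 0v ->
    nearest (s *v z +v t *v z1) (e1 *v k +v e2 *v d) = 0.
Proof.
  intros HX Hi Ez Ez1 Hi' H1k H1d Hz Hez s t Hst.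
  assert (Hi2 : indep2 z z1).
  { intros a c E. destruct (Hi' 0 a c) as [_ H]; [rewrite <- E; vlin|exact H]. }
  destruct (common_perpendicular X z z1 k HX Hi2) as [u [v Hp]].
  assert (Nz : z <> 0v).
  { intros E. destruct (Hi2 1 0) as [H _]; [rewrite E; vlin|lra]. }
  assert (Nz1 : z1 <> 0v).
  { intros E. destruct (Hi2 0 1) as [_ H]; [rewrite E; vlin|lra]. }
  pose proof (nearest_linear X z HX Nz) as [GA GS].
  pose proof (nearest_linear X z1 HX Nz1) as [G1A G1S].
  set (e := k -v u *v z -v v *v z1) in *.
  assert (Ee : e = (- u * z0 - v) *v x +v (1 - u * zk - v * b) *v k +v (- u * zd) *v d)
    by (unfold e; rewrite Ez, Ez1; vlin).
  assert (H1e : nearest z1 e = 0).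
  { pose proof (Hp 0 1) as H. replace (0 *v z +v 1 *v z1) with z1 in H by vlin. auto. }
  assert (Hze : nearest z e = 0).
  { pose proof (Hp 1 0) as H. replace (1 *v z +v 0 *v z1) with z in H by vlin. auto. }
  assert (H1x : nearest z1 x = 1).
  { replace x with (z1 +v (- b) *v k) by (rewrite Ez1; vlin).
    rewrite G1A, G1S, nearest_self, H1k by trivial. ring. }
  assert (C0 : - u * z0 - v = 0).
  { rewrite Ee, !G1A, !G1S, H1x, H1k, H1d in H1e. lra. }
  set (c2 := 1 - u * zk - v * b) in *. set (c3 := - u * zd) in *.
  assert (Ee' : e = c2 *v k +v c3 *v d) by (rewrite Ee, C0; vlin).
  assert (Hc : c2 <> 0 \/ c3 <> 0).
  { destruct (Req_dec c2 0) as [E2|]; auto. destruct (Req_dec c3 0) as [E3|]; auto.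
    exfalso. destruct (Hi' 1 (- u) (- v)) as [H _]; [|lra].
    transitivity e; [unfold e; vlin|]. rewrite Ee', E2, E3. vlin. }
  assert (HH : exists l, e1 = l * c2 /\ e2 = l * c3).
  { rewrite Ee', GA, !GS in Hze. rewrite GA, !GS in Hez.
    set (q := nearest z k) in *. set (p := nearest z d) in *.
    destruct (Req_dec c2 0) as [E2|N2].
    - assert (N3 : c3 <> 0) by lra.
      assert (Hp0 : p = 0).
      { rewrite E2 in Hze. destruct (Rmult_integral c3 p); [lra|contradiction|trivial]. }
      assert (He1 : e1 = 0).
      { rewrite Hp0 in Hez. destruct (Rmult_integral e1 q); [lra|trivial|].
        destruct Hz; contradiction. }
      exists (e2 / c3). rewrite E2, He1. split; field; trivial.
    - exists (e1 / c2). split; [field; trivial|].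
      assert (Hq : q = - (c3 * p) / c2) by (field_simplify_eq; lra).
      assert (Np : p <> 0).
      { intros E. destruct Hz as [Hz|Hz]; apply Hz; trivial. rewrite Hq, E. field; trivial. }
      rewrite Hq in Hez. apply (Rmult_eq_reg_r p); trivial.
      field_simplify_eq in Hez; trivial. field_simplify_eq; trivial. lra. }
  destruct HH as [l [-> ->]].
  replace ((l * c2) *v k +v (l * c3) *v d) with (l *v e) by (rewrite Ee'; vlin).
  rewrite (proj2 (nearest_linear X _ HX Hst)), Hp by trivial. ring.
Qed.

(* With [p = g_z(d)] and [q = g_z(k)] for [z = x + d], the vector [e = p k - q d] is orthogonal to [w]
   and to [x - k], whose span contains [e]; so the planes orthogonal to [w] and [x - k] coincide. *)
Lemma shared_plane_spreads (X : NormedSpace) (x k d : X) :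
  rotund_with_projections X -> indep3 x k d ->
  nearest x k = 0 -> nearest x d = 0 ->
  nearest (x -v k) k = 0 -> nearest (x -v k) d = 0 ->
  nearest (x +v d) k <> 0 ->
  exists t, t <> 0 /\ nearest (x +v t *v d) k = 0 /\ nearest (x +v t *v d) d = 0.
Proof.
  intros HX Hi Hxk Hxd Hyk Hyd Hq.
  set (z := x +v d) in *. set (q := nearest z k) in *. set (p := nearest z d).
  assert (Nz : z <> 0v).
  { replace z with (1 *v x +v 0 *v k +v 1 *v d) by (unfold z; vlin).
    apply indep3_combine_neq0; trivial; lra. }
  assert (Nx : x <> 0v).
  { replace x with (1 *v x +v 0 *v k +v 0 *v d) by vlin. apply indep3_combine_neq0; trivial; lra. }
  assert (Nd : d <> 0v).
  { replace d with (0 *v x +v 0 *v k +v 1 *v d) by vlin. apply indep3_combine_neq0; trivial; lra. }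
  set (e := p *v k +v (- q) *v d).
  assert (Ne : e <> 0v).
  { replace e with (0 *v x +v p *v k +v (- q) *v d) by (unfold e; vlin).
    apply indep3_combine_neq0; trivial; lra. }
  (* [w = e + p (x - k)] is common to the plane of [x] and [d], to which [e] is orthogonal, and to
     the plane of [e] and [x - k]. If [nearest w] kills [k] and [d], rescaling [w] gives the
     required point; otherwise [e] becomes orthogonal to itself. *)
  set (w := p *v x +v (- q) *v d).
  assert (Nw : w <> 0v).
  { replace w with (p *v x +v 0 *v k +v (- q) *v d) by (unfold w; vlin).
    apply indep3_combine_neq0; trivial; lra. }
  assert (Hw : nearest w e = 0).
  { replace w with ((- q) *v z +v (p + q) *v x) in * by (unfold z, w; vlin).
    apply (plane_perpendicular X x k d z x 1 0 1 0); trivial; try (unfold z; vlin).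
    - intros a b c E. destruct (Hi (b + c) a b) as [H1 [H2 H3]];
        [rewrite <- E; unfold z; vlin|lra].
    - left; exact Hq.
    - rewrite (proj1 (nearest_linear X z HX Nz)), !(proj2 (nearest_linear X z HX Nz)).
      fold p q. ring. }
  destruct (classic (nearest w k = 0 /\ nearest w d = 0)) as [[Hwk Hwd]|Hno].
  - assert (Np : p <> 0).
    { intros E. unfold w in Hwd. rewrite E in Hwd.
      replace (0 *v x +v (- q) *v d) with ((- q) *v d) in Hwd by vlin.
      rewrite nearest_scal_eq0, nearest_self in Hwd; trivial; lra. }
    assert (Nt : x +v (- q / p) *v d <> 0v).
    { replace (x +v (- q / p) *v d) with (1 *v x +v 0 *v k +v (- q / p) *v d) by vlin.
      apply indep3_combine_neq0; trivial; lra. }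
    assert (Ew : w = p *v (x +v (- q / p) *v d)) by (unfold w; vlin).
    rewrite Ew, nearest_scal_eq0 in Hwk, Hwd by trivial.
    exists (- q / p). split; [|auto].
    intros E. apply Hq. replace q with (- (- q / p * p)) by (field; trivial). rewrite E. ring.
  - exfalso.
    assert (H : nearest e e = 0).
    { assert (Ee : e = 1 *v w +v (- p) *v (x -v k)) by (unfold e, w; vlin).
      rewrite Ee in Ne. pattern e at 1. rewrite Ee.
      unfold e.
      apply (plane_perpendicular X x k d w (x -v k) p 0 (- q) (-1)); trivial;
        try (unfold w; vlin).
      - intros a b c E.
        destruct (Hi (b * p + c) (a - c) (- b * q)) as [H1 [H2 H3]];
          [rewrite <- E; unfold w; vlin|].
        assert (b = 0) by (destruct (Rmult_integral (- b) q H3); lra).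
        subst b. lra.
      - destruct (Req_dec (nearest w k) 0); auto. }
    rewrite nearest_self in H; trivial; lra.
Qed.

(** The direction of James' criterion that needs no smoothness. *)
Lemma norming_perpendicular (X : NormedSpace) (f : X -> R) (x y : X) :
  rotund_with_projections X -> x <> 0v ->
  linear_form f -> (forall z, Rabs (f z) <= vnorm z) -> f y = vnorm y ->
  f x = 0 -> nearest x y = 0.
Proof.
  intros HX Hx [fA fS] Hb Hy H. apply nearest_eq0; trivial. intros s.
  eapply Rle_trans; [|apply Hb]. eapply Rle_trans; [|apply RRle_abs].
  rewrite fA, fS, H, Hy. lra.
Qed.

(** If [f x <> 0], then [y] is orthogonal both to [x] and to the vector of [ker f] on [x + R y].
    With [e] a common perpendicular of [x] and [y], these two directions share the orthogonal plane
    of [y] and [e]. The set [K] of such directions, in the chart [x + r y + s e], is compact, and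
    [shared_plane_spreads] is played against an exposed point of it. *)
Lemma smoothness (X : NormedSpace) (f : X -> R) (x y w : X) :
  rotund_with_projections X -> indep3 x y w ->
  linear_form f -> (forall z, Rabs (f z) <= vnorm z) -> f y = vnorm y ->
  nearest x y = 0 -> f x = 0.
Proof.
  intros HX Hiw Hf Hfb Hfy Hxy. apply NNPP. intros Hfx.
  assert (Hixy : indep2 x y).
  { intros a b E. destruct (Hiw a b 0) as [H1 [H2 _]]; [rewrite <- E; vlin|auto]. }
  destruct (common_perpendicular X x y w HX Hixy) as [a [b Hperp]].
  set (e := w -v a *v x -v b *v y) in *.
  assert (Hi : indep3 x y e).
  { intros r s t E. destruct (Hiw (r - t * a) (s - t * b) t) as [H1 [H2 H3]].
    - rewrite <- E. unfold e. vlin.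
    - subst t. lra. }
  clearbody e. clear Hiw a b w.
  assert (Nz : forall r s, x +v r *v y +v s *v e <> 0v).
  { intros r s. replace (x +v r *v y) with (1 *v x +v r *v y) by vlin.
    apply indep3_combine_neq0; trivial; lra. }
  assert (Ny : y <> 0v).
  { replace y with (0 *v x +v 1 *v y +v 0 *v e) by vlin. apply indep3_combine_neq0; trivial; lra. }
  assert (Pos : 0 < vnorm y) by (apply vnorm_gt0; trivial).
  assert (Hiye : indep2 y e).
  { intros r s E. destruct (Hi 0 r s) as [_ H]; [rewrite <- E; vlin|auto]. }
  set (K := fun r s => nearest (x +v r *v y +v s *v e) y = 0 /\
                       nearest (x +v r *v y +v s *v e) e = 0).
  assert (K0 : K 0 0).
  { unfold K. replace (x +v 0 *v y +v 0 *v e) with x by vlin. split; trivial.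
    pose proof (Hperp 1 0) as H. replace (1 *v x +v 0 *v y) with x in H by vlin. apply H.
    intros E. destruct (Hixy 1 0) as [? _]; [rewrite E; vlin|lra]. }
  (* The parameter at which [f] vanishes on [x + R y]. *)
  set (r1 := - f x / vnorm y).
  assert (K1 : K r1 0).
  { assert (N1 := Nz r1 0). unfold K.
    assert (E1 : x +v r1 *v y +v 0 *v e = 1 *v x +v r1 *v y) by vlin. split.
    - apply norming_perpendicular with f; trivial. rewrite E1, (proj1 Hf), !(proj2 Hf), Hfy.
      unfold r1. field. lra.
    - rewrite E1 in *. apply Hperp; trivial. }
  assert (Hr1 : r1 <> 0).
  { intros E. apply Hfx. replace (f x) with (- (r1 * vnorm y)) by (unfold r1; field; lra).
    rewrite E. ring. }
  clearbody r1. clear Hperp Hixy Hfx Hfy Hfb Hf f Hxy.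
  destruct (coordinates_bounded X y e HX Hiye) as [C [HC0 HC]].
  (* [nearest z] is 1 at [x], so [x - z] is the image of [x] under a projection of norm at most
     1. *)
  assert (Bd : forall r s, K r s -> vnorm (r *v y +v s *v e) <= vnorm x).
  { intros r s [H1 H2]. set (z := x +v r *v y +v s *v e) in *.
    pose proof (nearest_linear X z HX (Nz r s)) as [GA GS].
    assert (Gx : nearest z x = 1).
    { replace x with (z +v (- r) *v y +v (- s) *v e) by (unfold z; vlin).
      rewrite !GA, !GS, H1, H2, nearest_self; trivial; [ring|apply Nz]. }
    pose proof (nearest_min X z x 0 HX (Nz r s)) as H. rewrite Gx in H.
    replace (x -v 0 *v z) with x in H by vlin.
    replace (x -v 1 *v z) with (vopp (r *v y +v s *v e)) in H by (unfold z; vlin).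
    rewrite vnorm_opp in H. trivial. }
  destruct (compact_argmin (fun r s c => K r s /\ c = 0)
    (fun r s c => - vnorm (x +v r *v y +v s *v e)) (C * vnorm x) (- (2 * vnorm x)))
    as [r0 [s0 [c0 [[Kz0 _] Hmax]]]].
  - exists 0, 0, 0; auto.
  - intros r s c [HK ->]. pose proof (Bd r s HK) as HB.
    apply (Rmult_le_compat_l C) in HB; trivial. destruct (HC r s). rewrite Rabs_R0.
    pose proof (Rabs_pos r). repeat split; lra.
  - intros r s c [HK ->]. pose proof (Bd r s HK) as HB.
    pose proof (vnorm_triangle X x (r *v y +v s *v e)) as H.
    replace (x +v (r *v y +v s *v e)) with (x +v r *v y +v s *v e) in H by vlin. lra.
  - intros r s c lr ls lc Hr Hs Hc HK. split; [split|].
    + assert (Cl : forall v, (forall n, nearest (x +v r n *v y +v s n *v e) v = 0) ->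
        nearest (x +v lr *v y +v ls *v e) v = 0).
      { intros v Hv. apply nearest_eq0; trivial. intros t.
        apply Un_cv_le with (fun _ => vnorm v)
          (fun n => vnorm ((v +v t *v x) +v (t * r n) *v y +v (t * s n) *v e)).
        - intros n. pose proof (proj1 (nearest_eq0 X _ v HX (Nz (r n) (s n))) (Hv n) t) as H.
          replace (v +v t *v (x +v r n *v y +v s n *v e))
            with (v +v t *v x +v (t * r n) *v y +v (t * s n) *v e) in H by vlin. exact H.
        - apply Un_cv_const.
        - replace (v +v t *v (x +v lr *v y +v ls *v e))
            with (v +v t *v x +v (t * lr) *v y +v (t * ls) *v e) by vlin.
          apply vnorm_affine_cv; apply CV_mult; trivial; apply Un_cv_const. }
      split; apply Cl; intros n; apply (HK n).
    + apply (UL_sequence c); trivial.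
      apply Un_cv_ext with (2 := Un_cv_const 0). intros n; symmetry; apply HK.
    + apply CV_opp. apply vnorm_affine_cv; trivial.
  - set (z0 := x +v r0 *v y +v s0 *v e) in *.
    assert (Nz0 : z0 <> 0v) by apply Nz.
    (* Rotundity makes the norm-maximal point [z0] of [K] exposed by a line in direction [d]. *)
    destruct (norming_functional X z0) as [h [Hh [Hhb Hhz]]].
    assert (Hd : exists d1 d2, (d1 <> 0 \/ d2 <> 0) /\ h (d1 *v y +v d2 *v e) = 0).
    { destruct (classic (h y = 0 /\ h e = 0)) as [[E1 E2]|Hno].
      - exists 1, 0. split; [left; lra|]. rewrite (proj1 Hh), !(proj2 Hh), E1. ring.
      - exists (h e), (- h y). split.
        + destruct (Req_dec (h e) 0); auto. right. intros E. apply Hno. lra.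
        + rewrite (proj1 Hh), !(proj2 Hh). ring. }
    destruct Hd as [d1 [d2 [Hd12 Hhd]]]. set (d := d1 *v y +v d2 *v e) in *.
    assert (Nd : d <> 0v).
    { intros E. destruct (Hiye _ _ E). lra. }
    (* On the line [z0 + R d] the norm is least at [z0], and only there by rotundity, whereas points
       of [K] have norm at most [vnorm z0]. *)
    assert (Hexp : forall t, K (r0 + t * d1) (s0 + t * d2) -> t = 0).
    { intros t HK. pose proof (norming_perpendicular X h d z0 HX Nd Hh Hhb Hhz Hhd) as H0.
      assert (H1 : nearest d z0 = - t); [|lra].
      apply nearest_unique; trivial. intros s.
      pose proof (Hmax _ _ 0 (conj HK eq_refl)) as Hm.
      replace (x +v (r0 + t * d1) *v y +v (s0 + t * d2) *v e) with (z0 -v - t *v d) in Hm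
        by (unfold z0, d; vlin).
      apply Rle_trans with (vnorm z0); [lra|].
      pose proof (nearest_min X d z0 s HX Nd) as H. rewrite H0 in H.
      replace (z0 -v 0 *v d) with z0 in H by vlin. exact H. }
    assert (Kz : forall k1 k2 r s, k1 * d2 - k2 * d1 <> 0 ->
      nearest (x +v r *v y +v s *v e) (k1 *v y +v k2 *v e) = 0 ->
      nearest (x +v r *v y +v s *v e) d = 0 -> K r s).
    { intros k1 k2 r s Hdet H1 H2.
      set (k := k1 *v y +v k2 *v e) in *. set (D := k1 * d2 - k2 * d1) in *.
      pose proof (nearest_linear X _ HX (Nz r s)) as [GA GS]. split.
      - replace y with ((d2 / D) *v k +v (- k2 / D) *v d) at 2
          by (unfold k, d, D; vcoefs; field; trivial).
        rewrite GA, !GS, H1, H2. ring.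
      - replace e with ((- d1 / D) *v k +v (k1 / D) *v d) at 2
          by (unfold k, d, D; vcoefs; field; trivial).
        rewrite GA, !GS, H1, H2. ring. }
    assert (Kl : forall r s u v, K r s ->
      nearest (x +v r *v y +v s *v e) (u *v y +v v *v e) = 0).
    { intros r s u v [H1 H2]. pose proof (nearest_linear X _ HX (Nz r s)) as [GA GS].
      rewrite GA, !GS, H1, H2. ring. }
    assert (Hdet : forall k1 k2, K (r0 - k1) (s0 - k2) -> (k1 <> 0 \/ k2 <> 0) ->
      k1 * d2 - k2 * d1 <> 0).
    { intros k1 k2 HK Hk E.
      assert (HH : exists l, k1 = l * d1 /\ k2 = l * d2).
      { destruct (Req_dec d1 0) as [E1|N1].
        - assert (N2 : d2 <> 0) by lra. exists (k2 / d2). rewrite E1 in *. split.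
          + rewrite Rmult_0_r in *. destruct (Rmult_integral k1 d2); [lra|lra|contradiction].
          + field; trivial.
        - exists (k1 / d1). split; [field; trivial|].
          field_simplify_eq; trivial. lra. }
      destruct HH as [l [-> ->]].
      assert (- l = 0).
      { apply Hexp. replace (r0 + - l * d1) with (r0 - l * d1) by ring.
        replace (s0 + - l * d2) with (s0 - l * d2) by ring. trivial. }
      assert (l = 0) by lra. subst l. lra. }
    assert (Hind : forall k1 k2 m, k1 * d2 - k2 * d1 <> 0 ->
      indep3 z0 (k1 *v y +v k2 *v e) (m *v (k1 *v y +v k2 *v e) +v d)).
    { intros k1 k2 m Hdk a b c E.
      destruct (Hi a (a * r0 + b * k1 + c * (m * k1 + d1)) (a * s0 + b * k2 + c * (m * k2 + d2)))
        as [H1 [H2 H3]].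
      - rewrite <- E. unfold z0, d. vlin.
      - subst a.
        assert (Hc : c * (k1 * d2 - k2 * d1) = 0).
        { replace (c * (k1 * d2 - k2 * d1)) with
            (k1 * (0 * s0 + b * k2 + c * (m * k2 + d2)) - k2 * (0 * r0 + b * k1 + c * (m * k1 + d1)))
            by ring. rewrite H2, H3. ring. }
        destruct (Rmult_integral _ _ Hc) as [->|]; [|contradiction].
        assert (Hb : b * (k1 * d2 - k2 * d1) = 0).
        { replace (b * (k1 * d2 - k2 * d1)) with
            (d2 * (0 * r0 + b * k1 + 0 * (m * k1 + d1)) - d1 * (0 * s0 + b * k2 + 0 * (m * k2 + d2)))
            by ring. rewrite H2, H3. ring. }
        destruct (Rmult_integral _ _ Hb) as [->|]; [|contradiction]. auto. }
    (* [shared_plane_spreads] at [z0] with second point [z0 - k]; [d] may be replaced by any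
       [m k + d], which spans the same plane with [k]. *)
    assert (Hstep : forall k1 k2 m, K (r0 - k1) (s0 - k2) -> (k1 <> 0 \/ k2 <> 0) ->
      nearest (z0 +v (m *v (k1 *v y +v k2 *v e) +v d)) (k1 *v y +v k2 *v e) <> 0 ->
      exists t, t <> 0 /\ K (r0 + t * (m * k1 + d1)) (s0 + t * (m * k2 + d2))).
    { intros k1 k2 m HK Hk Hq. pose proof (Hdet _ _ HK Hk) as HD.
      set (k := k1 *v y +v k2 *v e) in *.
      assert (Ed : m *v k +v d = (m * k1 + d1) *v y +v (m * k2 + d2) *v e)
        by (unfold k, d; vlin).
      assert (Ezk : z0 -v k = x +v (r0 - k1) *v y +v (s0 - k2) *v e) by (unfold z0, k; vlin).
      destruct (shared_plane_spreads X z0 k (m *v k +v d) HX (Hind k1 k2 m HD))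
        as [t [Ht [H1 H2]]]; trivial.
      - apply Kl; trivial.
      - rewrite Ed. apply Kl; trivial.
      - rewrite Ezk. apply Kl; trivial.
      - rewrite Ezk, Ed. apply Kl; trivial.
      - exists t. split; trivial.
        assert (Et : z0 +v t *v (m *v k +v d) =
          x +v (r0 + t * (m * k1 + d1)) *v y +v (s0 + t * (m * k2 + d2)) *v e)
          by (unfold z0, k, d; vlin).
        rewrite Et in H1, H2. apply (Kz k1 k2); trivial.
        rewrite (proj1 (nearest_linear X _ HX (Nz _ _))), (proj2 (nearest_linear X _ HX (Nz _ _))), H1
          in H2. lra. }
    (* The case [m = 0]: the alternative would be a second point of [K] on the exposing line. *)
    assert (Hflat : forall k1 k2, K (r0 - k1) (s0 - k2) -> nearest (z0 +v d) (k1 *v y +v k2 *v e) = 0).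
    { intros k1 k2 HK. destruct (classic (k1 <> 0 \/ k2 <> 0)) as [Hk|Hk].
      - apply NNPP. intros Hq. destruct (Hstep k1 k2 0 HK Hk) as [t [Ht HKt]].
        + replace (0 *v (k1 *v y +v k2 *v e) +v d) with d by vlin. trivial.
        + apply Ht, Hexp. replace d1 with (0 * k1 + d1) by ring.
          replace d2 with (0 * k2 + d2) by ring. trivial.
      - assert (k1 = 0) by (apply NNPP; auto). assert (k2 = 0) by (apply NNPP; auto). subst.
        assert (Nzd : z0 +v d <> 0v).
        { replace (z0 +v d) with (x +v (r0 + d1) *v y +v (s0 + d2) *v e) by (unfold z0, d; vlin).
          apply Nz. }
        rewrite (proj1 (nearest_linear X _ HX Nzd)), !(proj2 (nearest_linear X _ HX Nzd)). ring. }
    assert (Hk : exists k1 k2, K (r0 - k1) (s0 - k2) /\ (k1 <> 0 \/ k2 <> 0)).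
    { destruct (classic (r0 = 0 /\ s0 = 0)) as [[-> ->]|Hno].
      - exists (- r1), 0. split; [|left; lra].
        replace (0 - - r1) with r1 by ring. rewrite Rminus_0_r. trivial.
      - exists r0, s0. rewrite !Rminus_diag. split; trivial.
        destruct (Req_dec r0 0); auto. }
    destruct Hk as [k1 [k2 [HK Hk]]].
    pose proof (Hdet _ _ HK Hk) as HD. pose proof (Hflat _ _ HK) as Hfk.
    set (k := k1 *v y +v k2 *v e) in *.
    assert (Nk : k <> 0v) by (intros E; destruct (Hiye _ _ E); lra).
    assert (Ezd : z0 +v d = x +v (r0 + 1 * d1) *v y +v (s0 + 1 * d2) *v e)
      by (unfold z0, d; vlin).
    assert (Nzd : z0 +v d <> 0v) by (rewrite Ezd; apply Nz).
    (* A failure puts some [z0 + t (m k + d)] in [K]; [Hflat] for that point makes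
       [nearest (z0 +v d)] vanish on [m k + d], hence on [d], and [z0 + d] is then a point of [K] on
       the exposing line. *)
    assert (Hfar : forall m, nearest (z0 +v (m *v k +v d)) k = 0).
    { intros m. apply NNPP. intros Hq. destruct (Hstep k1 k2 m HK Hk Hq) as [t [Ht HKt]].
      assert (Hd0 : nearest (z0 +v d) d = 0).
      { assert (HF := Hflat (- t * (m * k1 + d1)) (- t * (m * k2 + d2))).
        replace (r0 - - t * (m * k1 + d1)) with (r0 + t * (m * k1 + d1)) in HF by ring.
        replace (s0 - - t * (m * k2 + d2)) with (s0 + t * (m * k2 + d2)) in HF by ring.
        specialize (HF HKt).
        replace ((- t * (m * k1 + d1)) *v y +v (- t * (m * k2 + d2)) *v e)
          with ((- t) *v (m *v k +v d)) in HF by (unfold k, d; vlin).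
        pose proof (nearest_linear X _ HX Nzd) as [GA GS].
        rewrite GS, GA, GS, Hfk in HF.
        destruct (Rmult_integral _ _ HF); lra. }
      assert (1 = 0); [|lra]. apply Hexp. apply (Kz k1 k2); trivial.
      - rewrite <- Ezd. trivial.
      - rewrite <- Ezd. trivial. }
    pose proof (vnorm_gt0 X k Nk) as Pk. pose proof (vnorm_ge0 X (z0 +v d)) as Pz.
    (* For large [m] the direction [z0 + d + m k] approaches [k], which is not orthogonal to itself;
       this [m] makes [vnorm (z0 +v d) / m] smaller than [vnorm k]. *)
    set (m := (vnorm (z0 +v d) + 1) / vnorm k).
    assert (Pm : 0 < m) by (apply Rdiv_lt_0_compat; lra).
    assert (Nm : z0 +v (m *v k +v d) <> 0v).
    { replace (z0 +v (m *v k +v d))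
        with (x +v (r0 + m * k1 + d1) *v y +v (s0 + m * k2 + d2) *v e)
        by (unfold z0, k, d; vlin). apply Nz. }
    pose proof (proj1 (nearest_eq0 X _ k HX Nm) (Hfar m) (- / m)) as H.
    replace (k +v - / m *v (z0 +v (m *v k +v d))) with (- / m *v (z0 +v d)) in H
      by (vcoefs; field; lra).
    rewrite vnorm_scal, Rabs_Ropp, Rabs_pos_eq in H
      by (left; apply Rinv_0_lt_compat; trivial).
    apply (Rmult_le_compat_l m) in H; [|lra].
    replace (m * (/ m * vnorm (z0 +v d))) with (vnorm (z0 +v d)) in H by (field; lra).
    replace (m * vnorm k) with (vnorm (z0 +v d) + 1) in H by (unfold m; field; lra). lra.
Qed.

(** * Orthogonality in three dimensions *)

(** An arbitrary choice of norming functional. Smoothness makes its zeros canonical, and only zeros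
    and ratios of its values matter afterwards. *)
Definition support {X : NormedSpace} (y : X) : X -> R :=
  proj1_sig (constructive_indefinite_description _ (norming_functional X y)).

Lemma support_spec (X : NormedSpace) (y : X) :
  linear_form (support y) /\ (forall x, Rabs (support y x) <= vnorm x) /\ support y y = vnorm y.
Proof. exact (proj2_sig (constructive_indefinite_description _ (norming_functional X y))). Qed.

Definition in_span3 {X : NormedSpace} (x1 x2 x3 v : X) : Prop :=
  exists a b c, v = a *v x1 +v b *v x2 +v c *v x3.

Lemma in_span3_combine (X : NormedSpace) (x1 x2 x3 v w : X) (a b : R) :
  in_span3 x1 x2 x3 v -> in_span3 x1 x2 x3 w -> in_span3 x1 x2 x3 (a *v v +v b *v w).
Proof.
  intros [v1 [v2 [v3 ->]]] [w1 [w2 [w3 ->]]].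
  exists (a * v1 + b * w1), (a * v2 + b * w2), (a * v3 + b * w3). vlin.
Qed.

Lemma indep2_or_multiple (X : NormedSpace) (z y : X) :
  z <> 0v -> indep2 z y \/ exists c, y = c *v z.
Proof.
  intros Hz. destruct (classic (exists c, y = c *v z)) as [|Hno]; auto. left.
  intros a b E.
  assert (Hb : b = 0).
  { apply NNPP. intros Hb. apply Hno. exists (- a / b).
    replace y with (/ b *v (a *v z +v b *v y) +v (- a / b) *v z) by vlin. rewrite E. vlin. }
  subst b. split; trivial. apply (vscal_eq0 X a z Hz). rewrite <- E. vlin.
Qed.

(* The third vector is the cross product of the coordinate vectors. *)
Lemma indep2_extend (X : NormedSpace) (x1 x2 x3 z y : X) :
  indep3 x1 x2 x3 -> in_span3 x1 x2 x3 z -> in_span3 x1 x2 x3 y -> indep2 z y ->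
  exists w, indep3 z y w.
Proof.
  intros Hi [z1 [z2 [z3 Ez]]] [y1 [y2 [y3 Ey]]] Hzy.
  set (n1 := z2 * y3 - z3 * y2). set (n2 := z3 * y1 - z1 * y3). set (n3 := z1 * y2 - z2 * y1).
  assert (Hcomb : forall a b, (a <> 0 \/ b <> 0) ->
    a * z1 + b * y1 = 0 -> a * z2 + b * y2 = 0 -> a * z3 + b * y3 = 0 -> False).
  { intros a b Hab H1 H2 H3. destruct (Hzy a b) as [Ha Hb]; [|lra].
    rewrite Ez, Ey.
    transitivity ((a * z1 + b * y1) *v x1 +v (a * z2 + b * y2) *v x2 +v (a * z3 + b * y3) *v x3);
      [vlin|]. rewrite H1, H2, H3. vlin. }
  assert (Hn : 0 < n1 * n1 + n2 * n2 + n3 * n3).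
  { apply Rnot_le_lt. intros Hle.
    assert (n1 = 0) by nra. assert (n2 = 0) by nra. assert (n3 = 0) by nra.
    unfold n1, n2, n3 in *.
    destruct (Req_dec z1 0) as [E1|N1].
    - destruct (Req_dec z2 0) as [E2|N2].
      + destruct (Req_dec z3 0) as [E3|N3].
        * apply (Hcomb 1 0); lra.
        * apply (Hcomb y3 (- z3)); lra.
      + apply (Hcomb y2 (- z2)); lra.
    - apply (Hcomb y1 (- z1)); lra. }
  exists (n1 *v x1 +v n2 *v x2 +v n3 *v x3). intros a b c E.
  destruct (Hi (a * z1 + b * y1 + c * n1) (a * z2 + b * y2 + c * n2) (a * z3 + b * y3 + c * n3))
    as [H1 [H2 H3]].
  { rewrite <- E, Ez, Ey. vlin. }
  assert (Hc : c * (n1 * n1 + n2 * n2 + n3 * n3) = 0).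
  { replace (c * (n1 * n1 + n2 * n2 + n3 * n3)) with
      (n1 * (a * z1 + b * y1 + c * n1) + n2 * (a * z2 + b * y2 + c * n2)
       + n3 * (a * z3 + b * y3 + c * n3)) by (unfold n1, n2, n3; ring).
    rewrite H1, H2, H3. ring. }
  destruct (Rmult_integral _ _ Hc) as [->|]; [|lra].
  destruct (Hzy a b) as [-> ->]; auto. rewrite <- E. vlin.
Qed.

(** One side is linear in [z], the other in [y]; playing these two linearities against each other
    drives the rest of the section. *)
Lemma support_eq0 (X : NormedSpace) (x1 x2 x3 y z : X) :
  rotund_with_projections X -> indep3 x1 x2 x3 ->
  in_span3 x1 x2 x3 y -> in_span3 x1 x2 x3 z -> y <> 0v -> z <> 0v ->
  support y z = 0 <-> nearest z y = 0.
Proof.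
  intros HX Hi Sy Sz Hy Hz. destruct (support_spec X y) as [Hl [Hb Hn]]. split.
  - intros H. apply norming_perpendicular with (support y); trivial.
  - intros H. destruct (indep2_or_multiple X z y Hz) as [Hzy|[c E]].
    + destruct (indep2_extend X x1 x2 x3 z y Hi Sz Sy Hzy) as [w Hw].
      apply (smoothness X (support y) z y w); trivial.
    + exfalso. rewrite E, (proj2 (nearest_linear X z HX Hz)), nearest_self in H by trivial.
      apply Hy. rewrite E. replace c with 0 by lra. apply vscal_0l.
Qed.

(** Let [z] in the plane of [z1] and [z2] be killed by [support y]. The vector [h = y' - c y] is
    orthogonal to [z1] and [z2], so [support h] kills both and therefore [z]; thus [nearest z] kills
    [h] and [y], hence [y'], and [support y'] kills [z] too. So the ratio of support values depends
    only on the ratio of the coordinates [nearest z1] and [nearest z2]. *)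
Lemma support_ratio (X : NormedSpace) (x1 x2 x3 y y' z1 z2 : X) (c : R) :
  rotund_with_projections X -> indep3 x1 x2 x3 ->
  in_span3 x1 x2 x3 y -> in_span3 x1 x2 x3 y' ->
  in_span3 x1 x2 x3 z1 -> in_span3 x1 x2 x3 z2 ->
  y <> 0v -> y' <> 0v -> indep2 z1 z2 ->
  nearest z1 y' = c * nearest z1 y -> nearest z2 y' = c * nearest z2 y ->
  support y' z1 * support y z2 = support y' z2 * support y z1.
Proof.
  intros HX Hi Sy Sy' S1 S2 Hy Hy' H12 E1 E2.
  destruct (support_spec X y) as [[A S] _]. destruct (support_spec X y') as [[A' S'] _].
  destruct (classic (support y z2 = 0 /\ support y z1 = 0)) as [[-> ->]|Hno]; [ring|].
  assert (N1 : z1 <> 0v) by (intros E; destruct (H12 1 0) as [? _]; [rewrite E; vlin|lra]).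
  assert (N2 : z2 <> 0v) by (intros E; destruct (H12 0 1) as [_ ?]; [rewrite E; vlin|lra]).
  set (z := support y z2 *v z1 +v (- support y z1) *v z2).
  assert (Nz : z <> 0v).
  { intros E. apply Hno. destruct (H12 _ _ E). lra. }
  assert (Sz : in_span3 x1 x2 x3 z) by (apply in_span3_combine; trivial).
  assert (Hzy : nearest z y = 0).
  { apply (support_eq0 X x1 x2 x3); trivial. unfold z. rewrite A, !S. ring. }
  set (h := 1 *v y' +v (- c) *v y).
  assert (Sh : in_span3 x1 x2 x3 h) by (apply in_span3_combine; trivial).
  pose proof (nearest_linear X z HX Nz) as [GA GS].
  pose proof (nearest_linear X z1 HX N1) as [G1A G1S].
  pose proof (nearest_linear X z2 HX N2) as [G2A G2S].
  assert (Hzh : nearest z h = 0).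
  { destruct (classic (h = 0v)) as [->|Nh].
    - rewrite <- (vscal_0l X z), GS. ring.
    - apply (support_eq0 X x1 x2 x3); trivial.
      destruct (support_spec X h) as [[Ah SSh] _]. unfold z. rewrite Ah, !SSh.
      rewrite (proj2 (support_eq0 X x1 x2 x3 h z1 HX Hi Sh S1 Nh N1)),
        (proj2 (support_eq0 X x1 x2 x3 h z2 HX Hi Sh S2 Nh N2)); [ring| |].
      + unfold h. rewrite G2A, !G2S, E2. ring.
      + unfold h. rewrite G1A, !G1S, E1. ring. }
  assert (Hzy' : nearest z y' = 0).
  { replace y' with (h +v c *v y) by (unfold h; vlin). rewrite GA, GS, Hzh, Hzy. ring. }
  apply (support_eq0 X x1 x2 x3) in Hzy'; trivial.
  unfold z in Hzy'. rewrite A', !S' in Hzy'. lra.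
Qed.

(** Squares are preserved, hence the order, and the integers are fixed. Comparison with the integer
    just above [n x] bounds [n (m x - x)] by 1 for every [n]. *)
Lemma real_endomorphism (m : R -> R) :
  (forall a b, m (a + b) = m a + m b) -> (forall a b, m (a * b) = m a * m b) -> m 1 = 1 ->
  forall x, m x = x.
Proof.
  intros A M M1.
  assert (M0 : m 0 = 0) by (pose proof (A 0 0) as H; rewrite Rplus_0_r in H; lra).
  assert (Mopp : forall x, m (- x) = - m x).
  { intros x. pose proof (A x (- x)) as H. rewrite Rplus_opp_r, M0 in H. lra. }
  assert (Mpos : forall x, 0 <= x -> 0 <= m x).
  { intros x Hx. rewrite <- (sqrt_sqrt x Hx), M. nra. }
  assert (Mle : forall x y, x <= y -> m x <= m y).
  { intros x y Hxy. pose proof (Mpos (y - x)) as H. unfold Rminus in H.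
    rewrite A, Mopp in H. lra. }
  assert (MN : forall n, m (INR n) = INR n).
  { induction n; [trivial|]. rewrite S_INR, A, IHn, M1. trivial. }
  assert (MZ : forall z, m (IZR z) = IZR z).
  { intros z. destruct (Z.le_gt_cases 0 z) as [Hz|Hz].
    - rewrite <- (Z2Nat.id z Hz), <- INR_IZR_INZ. apply MN.
    - replace (IZR z) with (- INR (Z.to_nat (- z))).
      + rewrite Mopp, MN. trivial.
      + rewrite INR_IZR_INZ, Z2Nat.id by lia. rewrite opp_IZR. ring. }
  assert (H : forall x n, INR n * (m x - x) <= 1).
  { intros x n. destruct (archimed (INR n * x)) as [H1 H2].
    pose proof (Mle (INR n * x) (IZR (up (INR n * x)))) as H3.
    rewrite M, MN, MZ in H3. lra. }
  assert (Hle : forall x, m x <= x).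
  { intros x. apply Rnot_lt_le. intros Hlt.
    destruct (archimed_cor1 (m x - x)) as [n [Hn Hn0]]; [lra|].
    apply lt_0_INR in Hn0. specialize (H x n).
    apply (Rmult_lt_compat_l (INR n)) in Hn; trivial. rewrite Rinv_r in Hn; lra. }
  intros x. apply Rle_antisym; trivial. pose proof (Hle (- x)) as H'. rewrite Mopp in H'. lra.
Qed.

(* The fundamental theorem of projective geometry for the correspondence [y |-> support y]. *)
Lemma support_linear_ratio (X : NormedSpace) (x1 x2 x3 : X) :
  rotund_with_projections X -> indep3 x1 x2 x3 ->
  nearest x1 x2 = 0 -> nearest x1 x3 = 0 -> nearest x2 x3 = 0 ->
  exists c, c <> 0 /\ forall y, in_span3 x1 x2 x3 y -> y <> 0v ->
    support y x1 * nearest x2 y = c * nearest x1 y * support y x2.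
Proof.
  intros HX Hi H12 H13 H23.
  assert (S1 : in_span3 x1 x2 x3 x1) by (exists 1, 0, 0; vlin).
  assert (S2 : in_span3 x1 x2 x3 x2) by (exists 0, 1, 0; vlin).
  assert (S3 : in_span3 x1 x2 x3 x3) by (exists 0, 0, 1; vlin).
  assert (N1 : x1 <> 0v) by
    (intros E; destruct (Hi 1 0 0) as [? _]; [rewrite E; vlin|lra]).
  assert (N2 : x2 <> 0v) by
    (intros E; destruct (Hi 0 1 0) as [_ [? _]]; [rewrite E; vlin|lra]).
  assert (N3 : x3 <> 0v) by
    (intros E; destruct (Hi 0 0 1) as [_ [_ ?]]; [rewrite E; vlin|lra]).
  pose proof (nearest_linear X x1 HX N1) as [G1A G1S].
  pose proof (nearest_linear X x2 HX N2) as [G2A G2S].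
  pose proof (nearest_linear X x3 HX N3) as [G3A G3S].
  pose proof (nearest_self X x1 HX N1) as G11. pose proof (nearest_self X x2 HX N2) as G22.
  pose proof (nearest_self X x3 HX N3) as G33.
  set (p := nearest x2 x1) in *. set (q := nearest x3 x1) in *. set (r := nearest x3 x2) in *.
  (* The triangular hypotheses make [nearest x1], [nearest x2], [nearest x3] coordinates on the
     span; [Y] inverts them. *)
  set (Y := fun t1 t2 t3 => t1 *v x1 +v (t2 - p * t1) *v x2
                            +v (t3 - q * t1 - r * (t2 - p * t1)) *v x3).
  assert (SY : forall t1 t2 t3, in_span3 x1 x2 x3 (Y t1 t2 t3)) by
    (intros; do 3 eexists; reflexivity).
  assert (Y1 : forall t1 t2 t3, nearest x1 (Y t1 t2 t3) = t1).
  { intros. unfold Y. rewrite !G1A, !G1S, G11, H12, H13. ring. }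
  assert (Y2 : forall t1 t2 t3, nearest x2 (Y t1 t2 t3) = t2).
  { intros. unfold Y. rewrite !G2A, !G2S, G22, H23. fold p. ring. }
  assert (Y3 : forall t1 t2 t3, nearest x3 (Y t1 t2 t3) = t3).
  { intros. unfold Y. rewrite !G3A, !G3S, G33. fold q r. ring. }
  assert (NY : forall t1 t2 t3, t1 <> 0 \/ t2 <> 0 \/ t3 <> 0 -> Y t1 t2 t3 <> 0v).
  { intros t1 t2 t3 Ht E.
    assert (G0 : forall x : X, x <> 0v -> nearest x (0v : X) = 0).
    { intros x Hx. rewrite <- (vscal_0l X x), (proj2 (nearest_linear X x HX Hx)). ring. }
    pose proof (Y1 t1 t2 t3) as E1. pose proof (Y2 t1 t2 t3) as E2. pose proof (Y3 t1 t2 t3) as E3.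
    rewrite E, G0 in E1, E2, E3 by trivial. lra. }
  assert (F1 : forall t1 t2 t3, t1 <> 0 \/ t2 <> 0 \/ t3 <> 0 ->
    support (Y t1 t2 t3) x1 = 0 <-> t1 = 0).
  { intros. rewrite (support_eq0 X x1 x2 x3), Y1; auto. reflexivity. }
  assert (F2 : forall t1 t2 t3, t1 <> 0 \/ t2 <> 0 \/ t3 <> 0 ->
    support (Y t1 t2 t3) x2 = 0 <-> t2 = 0).
  { intros. rewrite (support_eq0 X x1 x2 x3), Y2; auto. reflexivity. }
  assert (F3 : forall t1 t2 t3, t3 <> 0 -> support (Y t1 t2 t3) x3 <> 0).
  { intros t1 t2 t3 Ht. rewrite (support_eq0 X x1 x2 x3), Y3; auto. }
  assert (I12 : indep2 x1 x2).
  { intros a b E. destruct (Hi a b 0) as [? [? _]]; [rewrite <- E; vlin|auto]. }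
  assert (I13 : indep2 x1 x3).
  { intros a b E. destruct (Hi a 0 b) as [? [_ ?]]; [rewrite <- E; vlin|auto]. }
  assert (I23 : indep2 x2 x3).
  { intros a b E. destruct (Hi 0 a b) as [_ [? ?]]; [rewrite <- E; vlin|auto]. }
  (* For each pair of axes, the function that sends the coordinate ratio to the ratio of support
     values. *)
  set (th1 := fun t => support (Y t 0 1) x1 / support (Y t 0 1) x3).
  set (th2 := fun t => support (Y 0 t 1) x2 / support (Y 0 t 1) x3).
  set (th12 := fun u => support (Y u 1 0) x1 / support (Y u 1 0) x2).
  assert (T1 : forall t1 t2, support (Y t1 t2 1) x1 = th1 t1 * support (Y t1 t2 1) x3).
  { intros t1 t2. unfold th1. assert (H3 := F3 t1 0 1 ltac:(lra)).
    apply (Rmult_eq_reg_r (support (Y t1 0 1) x3)); trivial.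
    rewrite (support_ratio X x1 x2 x3 (Y t1 0 1) (Y t1 t2 1) x1 x3 1); trivial.
    - field; trivial.
    - apply NY; lra.
    - apply NY; lra.
    - rewrite !Y1. ring.
    - rewrite !Y3. ring. }
  assert (T2 : forall t1 t2, support (Y t1 t2 1) x2 = th2 t2 * support (Y t1 t2 1) x3).
  { intros t1 t2. unfold th2. assert (H3 := F3 0 t2 1 ltac:(lra)).
    apply (Rmult_eq_reg_r (support (Y 0 t2 1) x3)); trivial.
    rewrite (support_ratio X x1 x2 x3 (Y 0 t2 1) (Y t1 t2 1) x2 x3 1); trivial.
    - field; trivial.
    - apply NY; lra.
    - apply NY; lra.
    - rewrite !Y2. ring.
    - rewrite !Y3. ring. }
  assert (T12 : forall y u, in_span3 x1 x2 x3 y -> y <> 0v ->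
    nearest x1 y = u * nearest x2 y -> support y x1 = th12 u * support y x2).
  { intros y u Sy Ny Ey. unfold th12.
    assert (H3 : support (Y u 1 0) x2 <> 0) by (rewrite F2; lra).
    apply (Rmult_eq_reg_r (support (Y u 1 0) x2)); trivial.
    rewrite (support_ratio X x1 x2 x3 (Y u 1 0) y x1 x2 (nearest x2 y)); trivial.
    - field; trivial.
    - apply NY; lra.
    - rewrite !Y1, Ey. ring.
    - rewrite !Y2. ring. }
  assert (Z1 : th1 0 = 0).
  { unfold th1. rewrite (proj2 (F1 0 0 1 ltac:(lra))); trivial. unfold Rdiv; ring. }
  assert (Z2 : th2 0 = 0).
  { unfold th2. rewrite (proj2 (F2 0 0 1 ltac:(lra))); trivial. unfold Rdiv; ring. }
  assert (NZ1 : th1 1 <> 0).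
  { intros E. pose proof (T1 1 0) as H. rewrite E, Rmult_0_l in H.
    apply F1 in H; lra. }
  assert (NZ2 : th2 1 <> 0).
  { intros E. pose proof (T2 0 1) as H. rewrite E, Rmult_0_l in H.
    apply F2 in H; lra. }
  (* Evaluation at the coordinates [(u v, v, 1)], whose first two are in ratio [u]. *)
  assert (Mul : forall u v, th1 (u * v) = th12 u * th2 v).
  { intros u v. assert (H3 := F3 (u * v) v 1 ltac:(lra)).
    pose proof (T1 (u * v) v) as E1. pose proof (T2 (u * v) v) as E2.
    pose proof (T12 (Y (u * v) v 1) u (SY _ _ _) (NY (u * v) v 1 ltac:(lra))) as E12.
    rewrite Y1, Y2 in E12. specialize (E12 eq_refl). rewrite E1, E2 in E12.
    apply (Rmult_eq_reg_r (support (Y (u * v) v 1) x3)); trivial. lra. }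
  (* Relative to its value at [x3], [support y] takes the value [th1 t1 + th2 t2] at [x1 + x2]. By
     [support_ratio] this depends only on [nearest x4], which is affine in [t1] and [t2]: it is a
     function of [t1 al + t2 be] alone. *)
  assert (Add : forall a b, th1 (a + b) = th1 a + th1 b).
  { set (x4 := x1 +v x2).
    assert (S4 : in_span3 x1 x2 x3 x4) by (exists 1, 1, 0; unfold x4; vlin).
    assert (N4 : x4 <> 0v).
    { intros E. destruct (I12 1 1) as [? _]; [rewrite <- E; unfold x4; vlin|lra]. }
    assert (I43 : indep2 x4 x3).
    { intros a b E. destruct (Hi a a b) as [? [_ ?]];
        [rewrite <- E; unfold x4; vlin|auto]. }
    pose proof (nearest_linear X x4 HX N4) as [G4A G4S].
    set (al := nearest x4 (Y 1 0 0)). set (be := nearest x4 (Y 0 1 0)).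
    assert (Nal : al <> 0).
    { unfold al. rewrite <- (support_eq0 X x1 x2 x3) by (trivial; apply NY; lra).
      unfold x4. rewrite (proj1 (proj1 (support_spec X _))).
      rewrite (proj2 (F2 1 0 0 ltac:(lra)) eq_refl), Rplus_0_r, F1; lra. }
    assert (Nbe : be <> 0).
    { unfold be. rewrite <- (support_eq0 X x1 x2 x3) by (trivial; apply NY; lra).
      unfold x4. rewrite (proj1 (proj1 (support_spec X _))).
      rewrite (proj2 (F1 0 1 0 ltac:(lra)) eq_refl), Rplus_0_l, F2; lra. }
    assert (G4 : forall t1 t2, nearest x4 (Y t1 t2 1) = t1 * al + t2 * be + nearest x4 (Y 0 0 1)).
    { intros t1 t2. unfold al, be. rewrite <- !G4S, <- !G4A. f_equal. unfold Y. vlin. }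
    assert (Key : forall t1 t2 t1' t2', t1 * al + t2 * be = t1' * al + t2' * be ->
      th1 t1 + th2 t2 = th1 t1' + th2 t2').
    { intros t1 t2 t1' t2' E.
      assert (H3 := F3 t1 t2 1 ltac:(lra)). assert (H3' := F3 t1' t2' 1 ltac:(lra)).
      assert (H : support (Y t1' t2' 1) x4 * support (Y t1 t2 1) x3 =
                  support (Y t1' t2' 1) x3 * support (Y t1 t2 1) x4).
      { apply (support_ratio X x1 x2 x3 _ _ x4 x3 1); trivial.
        - apply NY; lra.
        - apply NY; lra.
        - rewrite (G4 t1 t2), (G4 t1' t2'). lra.
        - rewrite !Y3. ring. }
      unfold x4 in H. rewrite !(proj1 (proj1 (support_spec X _))), !T1, !T2 in H.
      apply (Rmult_eq_reg_r (support (Y t1' t2' 1) x3 * support (Y t1 t2 1) x3)).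
      - lra.
      - apply Rmult_integral_contrapositive_currified; trivial. }
    intros a b.
    pose proof (Key (a + b) 0 a (al / be * b)) as K1.
    pose proof (Key b 0 0 (al / be * b)) as K2.
    rewrite Z1, Z2 in *.
    assert (E1 : (a + b) * al + 0 * be = a * al + al / be * b * be) by (field; trivial).
    assert (E2 : b * al + 0 * be = 0 * al + al / be * b * be) by (field; trivial).
    specialize (K1 E1). specialize (K2 E2). lra. }
  assert (Lin : forall u, th1 u = th1 1 * u).
  { intros u.
    assert (H : th1 u / th1 1 = u).
    { apply (real_endomorphism (fun u => th1 u / th1 1)).
      - intros a b. rewrite Add. field; trivial.
      - intros a b. pose proof (Mul 1 b) as E1. rewrite Rmult_1_l in E1.
        pose proof (Mul a 1) as E2. rewrite Rmult_1_r in E2.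
        pose proof (Mul 1 1) as E3. rewrite Rmult_1_r in E3.
        pose proof (Mul a b) as E4.
        assert (E : th1 (a * b) * th1 1 = th1 a * th1 b).
        { rewrite E4, E3, E1, E2. ring. }
        field_simplify_eq; trivial.
      - field; trivial. }
    rewrite <- H at 2. field; trivial. }
  exists (th1 1 / th2 1). split.
  { intros E. apply NZ1. replace (th1 1) with (th1 1 / th2 1 * th2 1) by (field; trivial).
    rewrite E. ring. }
  intros y Sy Ny.
  destruct (Req_dec (nearest x2 y) 0) as [E|Ne].
  - rewrite (proj2 (support_eq0 X x1 x2 x3 y x2 HX Hi Sy S2 Ny N2) E), E. ring.
  - rewrite (T12 y (nearest x1 y / nearest x2 y)); trivial.
    + pose proof (Mul (nearest x1 y / nearest x2 y) 1) as E. rewrite Rmult_1_r, Lin in E.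
      replace (th12 (nearest x1 y / nearest x2 y))
        with (th1 1 * (nearest x1 y / nearest x2 y) / th2 1).
      * field; auto.
      * rewrite E. field; trivial.
    + field; trivial.
Qed.

(** With [p = nearest x2 x1], the coordinates of [y = a x1 + b x2] are [a] and [p a + b], so
    [support y] at [x1] and [x2] is proportional to [c a] and [p a + b]. The condition on [s] and
    [t] says that [support y] kills [s x1 + t x2]. *)
Lemma plane_orthogonality_form (X : NormedSpace) (x1 x2 w : X) :
  rotund_with_projections X -> indep3 x1 x2 w -> nearest x1 x2 = 0 ->
  exists c p, forall a b s t, s * (c * a) + t * (p * a + b) = 0 ->
    forall r, vnorm (a *v x1 +v b *v x2)
              <= vnorm (a *v x1 +v b *v x2 +v r *v (s *v x1 +v t *v x2)).
Proof.
  intros HX Hiw H12.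
  assert (Hi2 : indep2 x1 x2).
  { intros a b E. destruct (Hiw a b 0) as [? [? _]]; [rewrite <- E; vlin|auto]. }
  destruct (common_perpendicular X x1 x2 w HX Hi2) as [u [v Hperp]].
  set (x3 := w -v u *v x1 -v v *v x2) in *.
  assert (Hi : indep3 x1 x2 x3).
  { intros a b c E. destruct (Hiw (a - c * u) (b - c * v) c) as [H1 [H2 H3]].
    - rewrite <- E. unfold x3. vlin.
    - subst c. lra. }
  assert (N1 : x1 <> 0v) by
    (intros E; destruct (Hi 1 0 0) as [? _]; [rewrite E; vlin|lra]).
  assert (N2 : x2 <> 0v) by
    (intros E; destruct (Hi 0 1 0) as [_ [? _]]; [rewrite E; vlin|lra]).
  assert (H13 : nearest x1 x3 = 0).
  { pose proof (Hperp 1 0) as H. replace (1 *v x1 +v 0 *v x2) with x1 in H by vlin. auto. }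
  assert (H23 : nearest x2 x3 = 0).
  { pose proof (Hperp 0 1) as H. replace (0 *v x1 +v 1 *v x2) with x2 in H by vlin. auto. }
  destruct (support_linear_ratio X x1 x2 x3 HX Hi H12 H13 H23) as [c [Nc Hc]].
  exists c, (nearest x2 x1). intros a b s t E r.
  set (y := a *v x1 +v b *v x2). set (z := s *v x1 +v t *v x2).
  destruct (classic (y = 0v)) as [->|Ny]; [rewrite vnorm_0; apply vnorm_ge0|].
  destruct (classic (z = 0v)) as [->|Nz]; [apply Req_le; f_equal; vlin|].
  assert (Sy : in_span3 x1 x2 x3 y) by (exists a, b, 0; unfold y; vlin).
  assert (Sz : in_span3 x1 x2 x3 z) by (exists s, t, 0; unfold z; vlin).
  revert r. apply nearest_eq0; trivial.
  apply (support_eq0 X x1 x2 x3); trivial.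
  specialize (Hc y Sy Ny).
  assert (G1 : nearest x1 y = a).
  { unfold y. rewrite (proj1 (nearest_linear X x1 HX N1)), !(proj2 (nearest_linear X x1 HX N1)).
    rewrite nearest_self, H12; trivial. ring. }
  assert (G2 : nearest x2 y = nearest x2 x1 * a + b).
  { unfold y. rewrite (proj1 (nearest_linear X x2 HX N2)), !(proj2 (nearest_linear X x2 HX N2)).
    rewrite nearest_self; trivial. ring. }
  rewrite G1, G2 in Hc. set (p := nearest x2 x1) in *.
  destruct (support_spec X y) as [[A S] _]. unfold z. rewrite A, !S.
  destruct (Req_dec (p * a + b) 0) as [E2|N].
  - assert (Sy2 : support y x2 = 0).
    { apply (support_eq0 X x1 x2 x3); trivial.
      - exists 0, 1, 0; vlin.
      - rewrite G2; trivial. }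
    rewrite E2, Sy2 in *.
    assert (Na : a <> 0).
    { intros Ea. apply Ny. unfold y. rewrite Ea in *. replace b with 0 by lra. vlin. }
    assert (Hs : s * (c * a) = 0) by lra.
    destruct (Rmult_integral _ _ Hs) as [->|H]; [ring|].
    destruct (Rmult_integral _ _ H); contradiction.
  - apply (Rmult_eq_reg_r (p * a + b)); trivial.
    transitivity (support y x2 * (s * (c * a) + t * (p * a + b))); [|rewrite E; ring].
    transitivity (s * (support y x1 * (p * a + b)) + t * support y x2 * (p * a + b)); [ring|].
    rewrite Hc. ring.
Qed.

(** * Rigidity of the unit circle in a plane *)

Lemma bernoulli (t : R) (n : nat) : -1 <= t -> 1 + INR n * t <= (1 + t) ^ n.
Proof.
  intros Ht. induction n as [|n IH]; [simpl; lra|].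
  rewrite S_INR. simpl. pose proof (pos_INR n).
  assert ((1 + t) * (1 + INR n * t) <= (1 + t) * (1 + t) ^ n)
    by (apply Rmult_le_compat_l; lra).
  assert (0 <= INR n * (t * t)) by (apply Rmult_le_pos; nra). nra.
Qed.

Lemma unit_circle_angle (a b : R) : a * a + b * b = 1 -> exists th, cos th = a /\ sin th = b.
Proof.
  intros H. assert (Ha : -1 <= a <= 1) by nra.
  assert (E : sin (acos a) = Rabs b).
  { rewrite sin_acos by trivial. rewrite <- sqrt_Rsqr_abs. f_equal. unfold Rsqr. lra. }
  destruct (Rle_lt_dec 0 b) as [Hb|Hb].
  - exists (acos a). rewrite E, Rabs_pos_eq by trivial. split; trivial. apply cos_acos; trivial.
  - exists (- acos a). rewrite cos_neg, sin_neg, E, Rabs_left by trivial.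
    split; [apply cos_acos; trivial|ring].
Qed.

(* The hypothesis says that [a u1 + b u2] is orthogonal to [s u1 + t u2] whenever the pairing below
   vanishes. Its antisymmetric part [om] would make the unit circle a logarithmic spiral. *)
Lemma no_spiral (X : NormedSpace) (u1 u2 : X) (om : R) :
  u1 <> 0v ->
  (forall a b s t, s * a + t * b + om * (s * b - t * a) = 0 ->
     forall r, vnorm (a *v u1 +v b *v u2)
               <= vnorm (a *v u1 +v b *v u2 +v r *v (s *v u1 +v t *v u2))) ->
  om = 0 /\ forall a b, vnorm (a *v u1 +v b *v u2) ^ 2 = (a * a + b * b) * vnorm u1 ^ 2.
Proof.
  intros Hu H.
  set (n := fun psi => vnorm (cos psi *v u1 +v sin psi *v u2)).
  assert (Pn : forall psi, 0 <= n psi) by (intros; apply vnorm_ge0).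
  (* Turning the vector at angle [psi] by [d] gives [k d] times it plus [sin d] times a vector to
     which it is orthogonal, with coordinates [- sin psi + om cos psi] and [cos psi + om sin psi].
     The norm is thus multiplied by at least [k d]. *)
  set (k := fun d => cos d - om * sin d).
  assert (Step : forall psi d, 0 <= k d -> k d * n psi <= n (psi + d)).
  { intros psi d Hk. unfold n.
    replace (k d * vnorm (cos psi *v u1 +v sin psi *v u2))
      with (vnorm ((k d * cos psi) *v u1 +v (k d * sin psi) *v u2)).
    - eapply Rle_trans.
      + apply (H _ _ (- sin psi + om * cos psi) (cos psi + om * sin psi)) with (r := sin d).
        ring.
      + apply Req_le. f_equal. rewrite cos_plus, sin_plus. unfold k. vlin.
    - rewrite <- (Rabs_pos_eq (k d)) at 3 by trivial. rewrite <- vnorm_scal. f_equal. vlin. }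
  assert (Iter : forall m psi d, 0 <= k d -> k d ^ m * n psi <= n (psi + INR m * d)).
  { induction m as [|m IH]; intros psi d Hk.
    - simpl. rewrite Rmult_0_l, Rplus_0_r. lra.
    - rewrite S_INR. specialize (IH psi d Hk). pose proof (Step (psi + INR m * d) d Hk) as HS.
      replace (psi + (INR m + 1) * d) with (psi + INR m * d + d) by ring.
      apply (Rmult_le_compat_l (k d)) in IH; trivial. simpl. lra. }
  assert (Dk : derivable_pt_lim k 0 (- om)).
  { replace (- om) with (- sin 0 - om * cos 0) by (rewrite sin_0, cos_0; ring).
    apply derivable_pt_lim_minus; [apply derivable_pt_lim_cos|].
    apply derivable_pt_lim_scal. apply derivable_pt_lim_sin. }
  assert (k0 : k 0 = 1) by (unfold k; rewrite cos_0, sin_0; ring).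
  (* [m] turns by [h = th / m] multiply the norm by at least [(1 + q h) ^ m], where [q] is close to
     the derivative [- om] of [k] at 0. The limit would be [exp (- om th)], but its linear lower
     bound, given by Bernoulli's inequality, is enough. *)
  assert (Grow : forall psi th, (1 - om * th) * n psi <= n (psi + th)).
  { intros psi th. destruct (Req_dec th 0) as [->|Nth].
    { rewrite Rplus_0_r. lra. }
    assert (Pth : 0 < Rabs th) by (apply Rabs_pos_lt; trivial).
    apply le_epsilon. intros e He.
    set (e' := e / (Rabs th * (n psi + 1))).
    assert (Pe' : 0 < e').
    { apply Rdiv_lt_0_compat; trivial. pose proof (Pn psi). nra. }
    destruct (Dk e' Pe') as [[d0 Pd0] Hd0]. simpl in Hd0.
    set (B := Rabs om + e').
    assert (PB : 0 < B) by (unfold B; pose proof (Rabs_pos om); lra).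
    (* One term of the bound makes [h] shorter than [d0], where the derivative estimate holds; the
       other gives [Rabs (q * h) <= 1], as Bernoulli's inequality requires. *)
    destruct (INR_unbounded (Rabs th / d0 + Rabs th * B)) as [m Hm].
    assert (P1 : 0 < Rabs th / d0) by (apply Rdiv_lt_0_compat; trivial).
    assert (P2 : 0 < Rabs th * B) by (apply Rmult_lt_0_compat; trivial).
    assert (Pm : 0 < INR m) by lra.
    set (h := th / INR m).
    assert (Eh : Rabs h = Rabs th / INR m).
    { unfold h, Rdiv. rewrite Rabs_mult, Rabs_inv, (Rabs_pos_eq (INR m)); lra. }
    assert (Nh : h <> 0).
    { intros E. apply Nth. replace th with (h * INR m) by (unfold h; field; lra). rewrite E. ring. }
    assert (Hh : Rabs h < d0).
    { rewrite Eh. apply (Rmult_lt_reg_r (INR m)); trivial.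
      replace (Rabs th / INR m * INR m) with (Rabs th) by (field; lra).
      assert (Rabs th / d0 * d0 < INR m * d0) by (apply Rmult_lt_compat_r; lra).
      replace (Rabs th / d0 * d0) with (Rabs th) in * by (field; lra). lra. }
    specialize (Hd0 h Nh Hh). rewrite Rplus_0_l, k0 in Hd0.
    set (q := (k h - 1) / h) in *.
    assert (Eq : k h = 1 + q * h) by (unfold q; field; trivial).
    assert (Hq : Rabs q <= B).
    { pose proof (Rabs_triang (q - - om) (- om)) as Ht. rewrite Rabs_Ropp in Ht.
      replace (q - - om + - om) with q in Ht by ring. unfold B. lra. }
    assert (Hqh : -1 <= q * h).
    { assert (Rabs (q * h) <= 1).
      { rewrite Rabs_mult, Eh. apply Rle_trans with (B * (Rabs th / INR m)).
        - apply Rmult_le_compat_r; trivial. rewrite <- Eh. apply Rabs_pos.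
        - apply (Rmult_le_reg_r (INR m)); trivial.
          replace (B * (Rabs th / INR m) * INR m) with (Rabs th * B) by (field; lra). lra. }
      pose proof (RRle_abs (- (q * h))) as Ha. rewrite Rabs_Ropp in Ha. lra. }
    pose proof (Iter m psi h ltac:(lra)) as HI.
    replace (psi + INR m * h) with (psi + th) in HI by (unfold h; field; lra).
    pose proof (bernoulli (q * h) m Hqh) as HB. rewrite <- Eq in HB.
    replace (INR m * (q * h)) with (q * th) in HB by (unfold h; field; lra).
    assert (HC : - om * th - e' * Rabs th <= q * th).
    { pose proof (RRle_abs (- ((q - - om) * th))) as Ha. rewrite Rabs_Ropp, Rabs_mult in Ha.
      assert (Rabs (q - - om) * Rabs th <= e' * Rabs th)
        by (apply Rmult_le_compat_r; lra). lra. }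
    pose proof (Pn psi) as Hn.
    assert (HD : (1 + (- om * th - e' * Rabs th)) * n psi <= n (psi + th)).
    { eapply Rle_trans; [|exact HI]. apply Rmult_le_compat_r; lra. }
    assert (HE : e' * Rabs th * n psi <= e).
    { assert (E : e' * Rabs th * (n psi + 1) = e) by (unfold e'; field; lra).
      assert (0 < e' * Rabs th) by (apply Rmult_lt_0_compat; trivial). lra. }
    lra. }
  assert (n0 : n 0 = vnorm u1).
  { unfold n. rewrite cos_0, sin_0. f_equal. vlin. }
  assert (P0 : 0 < vnorm u1) by (apply vnorm_gt0; trivial).
  (* Half a turn in either direction ends at [- u1], which has the norm of [u1]; this excludes both
     signs of [om]. *)
  assert (Hom : om = 0).
  { pose proof PI_RGT_0 as HPI.
    pose proof (Grow 0 PI) as G1. pose proof (Grow 0 (- PI)) as G2.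
    rewrite !Rplus_0_l in G1, G2.
    assert (E1 : n PI = vnorm u1).
    { unfold n. rewrite cos_PI, sin_PI, <- (vnorm_opp X u1). f_equal. vlin. }
    assert (E2 : n (- PI) = vnorm u1).
    { unfold n. rewrite cos_neg, sin_neg, cos_PI, sin_PI, <- (vnorm_opp X u1). f_equal. vlin. }
    rewrite E1, n0 in G1. rewrite E2, n0 in G2.
    assert (H1 : 0 <= om * (PI * vnorm u1)) by lra.
    assert (H2 : om * (PI * vnorm u1) <= 0) by lra.
    assert (H3 : 0 < PI * vnorm u1) by (apply Rmult_lt_0_compat; trivial).
    assert (H4 : om * (PI * vnorm u1) = 0) by lra.
    destruct (Rmult_integral _ _ H4); lra. }
  split; trivial. subst om.
  assert (Const : forall th, n th = vnorm u1).
  { intros th. pose proof (Grow 0 th) as G1. pose proof (Grow th (- th)) as G2.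
    rewrite Rplus_0_l in G1. rewrite Rplus_opp_r in G2. rewrite n0 in *. lra. }
  intros a b. destruct (Req_dec (a * a + b * b) 0) as [E|Ne].
  - assert (a = 0) by nra. assert (b = 0) by nra. subst.
    replace (0 *v u1 +v 0 *v u2) with (0v : X) by vlin. rewrite vnorm_0. ring.
  - assert (Pr : 0 < a * a + b * b) by nra.
    pose proof (sqrt_lt_R0 _ Pr) as Ps. pose proof (sqrt_sqrt _ (Rlt_le _ _ Pr)) as Es.
    set (r := sqrt (a * a + b * b)) in *.
    destruct (unit_circle_angle (a / r) (b / r)) as [th [E1 E2]].
    { field_simplify_eq; lra. }
    replace (a *v u1 +v b *v u2) with (r *v (cos th *v u1 +v sin th *v u2))
      by (rewrite E1, E2; vlin).
    rewrite vnorm_scal, Rabs_pos_eq by lra. fold (n th). rewrite Const, <- Es. ring.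
Qed.

Lemma pythagoras_dim3 (X : NormedSpace) (x h w : X) :
  rotund_with_projections X -> indep3 x h w -> nearest x h = 0 ->
  forall t, vnorm (h +v t *v x) ^ 2 = vnorm h ^ 2 + t ^ 2 * vnorm x ^ 2.
Proof.
  intros HX Hi Hxh t.
  destruct (plane_orthogonality_form X x h w HX Hi Hxh) as [c [p Hform]].
  assert (Hi2 : indep2 x h).
  { intros a b E. destruct (Hi a b 0) as [? [? _]]; [rewrite <- E; vlin|auto]. }
  (* Otherwise [t^2 + p t + c] has the real root [s - p / 2], and [x + (s - p / 2) h] is orthogonal
     to itself. *)
  assert (Hdisc : 0 < c - p ^ 2 / 4).
  { apply Rnot_le_lt. intros Hle.
    pose proof (sqrt_sqrt (p ^ 2 / 4 - c) ltac:(lra)) as Es.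
    set (s := sqrt (p ^ 2 / 4 - c)) in *.
    pose proof (Hform 1 (s - p / 2) 1 (s - p / 2)) as H.
    specialize (H ltac:(nra) (-1)).
    replace (1 *v x +v (s - p / 2) *v h +v -1 *v (1 *v x +v (s - p / 2) *v h))
      with (0v : X) in H by vlin.
    rewrite vnorm_0 in H.
    destruct (Hi2 1 (s - p / 2)) as [? _]; [|lra].
    apply vnorm_eq0. apply Rle_antisym; trivial. apply vnorm_ge0. }
  pose proof (sqrt_lt_R0 _ Hdisc) as Pk. pose proof (sqrt_sqrt _ (Rlt_le _ _ Hdisc)) as Ek.
  set (k := sqrt (c - p ^ 2 / 4)) in *.
  (* Completing the square, the symmetric part of the form is [(k a)^2 + (b + p a / 2)^2]. The two
     vectors given here are orthonormal for it, and [- p / (2 k)] is the antisymmetric part in that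
     basis. *)
  destruct (no_spiral X (/ k *v x +v (- p / (2 * k)) *v h) h (- p / (2 * k))) as [Hom Hn].
  - intros E. destruct (Hi2 _ _ E) as [H _]. apply Rinv_neq_0_compat in H; lra.
  - intros a b s t' E r.
    replace (a *v (/ k *v x +v (- p / (2 * k)) *v h) +v b *v h)
      with ((a / k) *v x +v (b - a * p / (2 * k)) *v h) by vlin.
    replace (s *v (/ k *v x +v (- p / (2 * k)) *v h) +v t' *v h)
      with ((s / k) *v x +v (t' - s * p / (2 * k)) *v h) by vlin.
    apply Hform. rewrite <- E.
    replace c with (k * k + p ^ 2 / 4) by lra. field. lra.
  - assert (Hp : p = 0).
    { replace p with (- (2 * k * (- p / (2 * k)))) by (field; lra). rewrite Hom. ring. }
    subst p.
    assert (Hv : forall a b, vnorm (a *v x +v b *v h) ^ 2 =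
      ((a * k) ^ 2 + b ^ 2) * vnorm (/ k *v x +v (- 0 / (2 * k)) *v h) ^ 2).
    { intros a b. replace (a *v x +v b *v h)
        with ((a * k) *v (/ k *v x +v (- 0 / (2 * k)) *v h) +v b *v h) by vlin.
      rewrite Hn. ring. }
    pose proof (Hv 1 0) as H1. pose proof (Hv 0 1) as H2. pose proof (Hv t 1) as H3.
    replace (1 *v x +v 0 *v h) with x in H1 by vlin.
    replace (0 *v x +v 1 *v h) with h in H2 by vlin.
    replace (t *v x +v 1 *v h) with (h +v t *v x) in H3 by vlin.
    rewrite H1, H2, H3. ring.
Qed.

(** * Two-dimensional spaces *)

(* Strict log-concavity of the determinant. *)
Lemma det_average_unique (A B C A' B' C' D : R) :
  0 < D -> 0 <= A -> 0 <= C -> 0 <= A' -> 0 <= C' ->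
  A * C - B * B = D -> A' * C' - B' * B' = D ->
  (A + A') / 2 * ((C + C') / 2) - (B + B') / 2 * ((B + B') / 2) <= D ->
  A' = A /\ B' = B /\ C' = C.
Proof.
  intros HD PA PC PA' PC' E E' H.
  assert (NA : 0 < A) by (destruct PA as [|<-]; trivial; nra).
  assert (NA' : 0 < A') by (destruct PA' as [|<-]; trivial; nra).
  assert (EC : C = (D + B * B) / A) by (field_simplify_eq; lra).
  assert (EC' : C' = (D + B' * B') / A') by (field_simplify_eq; lra).
  assert (H1 : A * C' + A' * C - 2 * B * B' <= 2 * D) by lra.
  assert (H2 : D * (A - A') ^ 2 + (A * B' - A' * B) ^ 2 <= 0).
  { replace (D * (A - A') ^ 2 + (A * B' - A' * B) ^ 2)
      with (A * A' * (A * C' + A' * C - 2 * B * B' - 2 * D))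
      by (rewrite EC, EC'; field; lra).
    assert (0 < A * A') by (apply Rmult_lt_0_compat; trivial). nra. }
  pose proof (pow2_ge_0 (A - A')) as S1. pose proof (pow2_ge_0 (A * B' - A' * B)) as S2.
  assert (Z1 : (A - A') ^ 2 = 0) by nra.
  assert (EA : A' = A) by nra.
  assert (Z2 : (A * B' - A' * B) ^ 2 = 0) by nra.
  assert (EB : B' = B).
  { rewrite EA in Z2. assert (A * (B' - B) = 0) by nra.
    destruct (Rmult_integral A (B' - B)); lra. }
  repeat split; trivial. rewrite EC, EC', EA, EB. reflexivity.
Qed.

(* The largest ellipse inscribed in the unit ball is unique, hence invariant under isometries;
   since the orbit of [u] is weakly dense in the unit sphere, it is a multiple of the ball. *)
Lemma quadratic_norm_dim2 (X : NormedSpace) (u x1 x2 : X) :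
  rotund_with_projections X -> omega_LUR X -> big_point u -> indep2 x1 x2 ->
  (forall v : X, exists a b, v = a *v x1 +v b *v x2) ->
  exists A B C, forall a b,
    vnorm (a *v x1 +v b *v x2) ^ 2 = A * (a * a) + 2 * B * (a * b) + C * (b * b).
Proof.
  intros HX HL Hu Hi Hspan.
  set (N := fun a b => vnorm (a *v x1 +v b *v x2)).
  assert (PN : forall a b, 0 <= N a b) by (intros; apply vnorm_ge0).
  set (Q := fun A B C a b : R => A * (a * a) + 2 * B * (a * b) + C * (b * b)).
  (* [Q <= N^2] puts the unit ball inside the region [Q <= 1], of area [PI / sqrt (A C - B^2)].
     Maximal determinant thus means least area around the ball or, for polars, largest area inside
     the dual ball. *)
  set (K := fun A B C => 0 <= A /\ 0 <= C /\ B * B <= A * C /\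
                         forall a b, Q A B C a b <= N a b ^ 2).
  set (M := N 1 0 ^ 2 + N 0 1 ^ 2).
  assert (KA : forall A B C, K A B C -> A <= N 1 0 ^ 2 /\ C <= N 0 1 ^ 2).
  { intros A B C [_ [_ [_ H]]]. pose proof (H 1 0) as H1. pose proof (H 0 1) as H2.
    unfold Q in H1, H2. lra. }
  destruct (coordinates_bounded X x1 x2 HX Hi) as [c0 [Hc0 Hc]].
  destruct (compact_argmin K (fun A B C => B * B - A * C) M (- (M * M)))
    as [A [B [C [HK Hmax]]]].
  - exists 0, 0, 0. split; [lra|split; [lra|split; [lra|]]]. intros a b. unfold Q.
    pose proof (pow2_ge_0 (N a b)). lra.
  - intros A B C HK. destruct (KA _ _ _ HK) as [H1 H2]. destruct HK as [PA [PC [HB _]]].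
    pose proof (pow2_ge_0 (N 1 0)). pose proof (pow2_ge_0 (N 0 1)).
    assert (HB' : Rabs B <= A + C).
    { rewrite <- (Rabs_pos_eq (A + C)) by lra. apply Rsqr_le_abs_0. unfold Rsqr.
      assert (0 <= A * A) by nra. assert (0 <= C * C) by nra.
      assert (0 <= A * C) by (apply Rmult_le_pos; trivial). lra. }
    unfold M. rewrite (Rabs_pos_eq A PA), (Rabs_pos_eq C PC). repeat split; lra.
  - intros A B C HK. destruct (KA _ _ _ HK) as [H1 H2]. destruct HK as [PA [PC [HB _]]].
    pose proof (pow2_ge_0 (N 1 0)). pose proof (pow2_ge_0 (N 0 1)).
    assert (A * C <= M * M) by (apply Rmult_le_compat; unfold M; lra). nra.
  - intros A B C lA lB lC HA HB HC HK. split.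
    + split; [|split; [|split]].
      * apply Un_cv_le with (2 := Un_cv_const 0) (3 := HA). intros n; apply HK.
      * apply Un_cv_le with (2 := Un_cv_const 0) (3 := HC). intros n; apply HK.
      * apply Un_cv_le with (2 := CV_mult _ _ _ _ HB HB) (3 := CV_mult _ _ _ _ HA HC).
        intros n; apply HK.
      * intros a b. apply Un_cv_le with (fun n => Q (A n) (B n) (C n) a b) (fun _ => N a b ^ 2).
        -- intros n; apply HK.
        -- unfold Q. apply CV_plus; [apply CV_plus|]; apply CV_mult; try apply Un_cv_const;
             trivial. apply CV_mult; trivial; apply Un_cv_const.
        -- apply Un_cv_const.
    + apply CV_minus; apply CV_mult; trivial.
  - set (D := A * C - B * B).
    assert (PD : 0 < D).
    { set (e := / (2 * (c0 * c0) + 1)).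
      assert (Pe : 0 < e) by (apply Rinv_0_lt_compat; nra).
      assert (Ke : K e 0 e).
      { split; [lra|split; [lra|split; [nra|]]]. intros a b. unfold Q.
        destruct (Hc a b) as [H1 H2]. fold (N a b) in H1, H2. specialize (PN a b).
        assert (S1 : a * a <= c0 * c0 * N a b ^ 2).
        { replace (c0 * c0 * N a b ^ 2) with (Rsqr (c0 * N a b)) by (unfold Rsqr; ring).
          change (a * a) with (Rsqr a). apply Rsqr_le_abs_1.
          rewrite (Rabs_pos_eq (c0 * N a b)); trivial. apply Rmult_le_pos; trivial. }
        assert (S2 : b * b <= c0 * c0 * N a b ^ 2).
        { replace (c0 * c0 * N a b ^ 2) with (Rsqr (c0 * N a b)) by (unfold Rsqr; ring).
          change (b * b) with (Rsqr b). apply Rsqr_le_abs_1.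
          rewrite (Rabs_pos_eq (c0 * N a b)); trivial. apply Rmult_le_pos; trivial. }
        assert (S3 : e * (a * a + b * b) <= e * ((2 * (c0 * c0) + 1) * N a b ^ 2)).
        { apply Rmult_le_compat_l; [lra|]. pose proof (pow2_ge_0 (N a b)). lra. }
        replace (e * ((2 * (c0 * c0) + 1) * N a b ^ 2)) with (N a b ^ 2) in S3
          by (unfold e; field; nra). lra. }
      specialize (Hmax _ _ _ Ke). unfold D. nra. }
    destruct (choice (fun v (p : R * R) => v = fst p *v x1 +v snd p *v x2)) as [co Hco].
    { intros v. destruct (Hspan v) as [a [b E]]. exists (a, b). exact E. }
    assert (Hco' : forall a b, co (a *v x1 +v b *v x2) = (a, b)).
    { intros a b. assert (E := Hco (a *v x1 +v b *v x2)).
      destruct (co (a *v x1 +v b *v x2)) as [a' b']. simpl in E.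
      destruct (Hi (a' - a) (b' - b)) as [H1 H2]; [|f_equal; lra].
      transitivity ((a' *v x1 +v b' *v x2) -v (a *v x1 +v b *v x2)); [vlin|].
      rewrite <- E. vlin. }
    set (q := fun v => Q A B C (fst (co v)) (snd (co v))).
    (* The pullback of [Q] by an isometry is again in [K], with determinant multiplied by that of
       [T] squared; maximality bounds this factor by 1. *)
    assert (Hmat : forall T : X -> X, surj_lin_isometry T -> exists m11 m12 m21 m22,
      (forall a b, T (a *v x1 +v b *v x2)
         = (m11 * a + m12 * b) *v x1 +v (m21 * a + m22 * b) *v x2) /\
      K (Q A B C m11 m21) (A * m11 * m12 + B * (m11 * m22 + m12 * m21) + C * m21 * m22)
        (Q A B C m12 m22) /\
      (m11 * m22 - m12 * m21) ^ 2 <= 1).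
    { intros T [[TA TS] [_ TN]].
      destruct (Hspan (T x1)) as [m11 [m21 E1]]. destruct (Hspan (T x2)) as [m12 [m22 E2]].
      assert (HT : forall a b, T (a *v x1 +v b *v x2)
         = (m11 * a + m12 * b) *v x1 +v (m21 * a + m22 * b) *v x2).
      { intros a b. rewrite TA, !TS, E1, E2. vlin. }
      assert (HK' : K (Q A B C m11 m21)
        (A * m11 * m12 + B * (m11 * m22 + m12 * m21) + C * m21 * m22) (Q A B C m12 m22)).
      { assert (Qpos : forall a b, 0 <= Q A B C a b).
        { intros a b. destruct HK as [PA [PC [HB _]]].
          assert (NA : 0 < A) by (destruct PA as [|EA]; trivial; subst A; unfold D in PD; nra).
          assert (E : A * Q A B C a b = (A * a + B * b) ^ 2 + D * b ^ 2)
            by (unfold Q, D; ring).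
          pose proof (pow2_ge_0 (A * a + B * b)). pose proof (pow2_ge_0 b).
          assert (0 <= D * b ^ 2) by (apply Rmult_le_pos; lra).
          apply (Rmult_le_reg_l A); lra. }
        split; [apply Qpos|split; [apply Qpos|split]].
        - assert (0 <= (m11 * m22 - m12 * m21) ^ 2 * D)
            by (apply Rmult_le_pos; [apply pow2_ge_0|lra]).
          unfold Q, D in *. lra.
        - intros a b. unfold N. rewrite <- TN, HT.
          eapply Rle_trans; [|apply HK]. unfold Q. apply Req_le. ring. }
      exists m11, m12, m21, m22. split; [|split]; trivial.
      pose proof (Hmax _ _ _ HK') as H.
      assert (H' : (m11 * m22 - m12 * m21) ^ 2 * D <= 1 * D) by (unfold Q, D in *; lra).
      apply Rmult_le_reg_r in H'; trivial. }
    (* The bounds for [T] and its inverse give squared determinant 1, so [Q] and its pullback are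
       both maximal. Their average is in [K], and [det_average_unique] identifies them. *)
    assert (Hinv : forall T : X -> X, surj_lin_isometry T -> forall v, q (T v) = q v).
    { intros T HT v.
      destruct (isometry_inverse X T HT) as [S [HS [HST _]]].
      destruct (Hmat T HT) as [m11 [m12 [m21 [m22 [ET [HK' Hd]]]]]].
      destruct (Hmat S HS) as [n11 [n12 [n21 [n22 [ES [_ Hd']]]]]].
      assert (E1 : forall a b, n11 * (m11 * a + m12 * b) + n12 * (m21 * a + m22 * b) = a /\
                               n21 * (m11 * a + m12 * b) + n22 * (m21 * a + m22 * b) = b).
      { intros a b. pose proof (Hco' a b) as H.
        rewrite <- (HST (a *v x1 +v b *v x2)), ET, ES, Hco' in H.
        injection H; auto. }
      destruct (E1 1 0) as [F1 F2]. destruct (E1 0 1) as [F3 F4].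
      assert (Hdet : (n11 * n22 - n12 * n21) * (m11 * m22 - m12 * m21) = 1).
      { transitivity ((n11 * m11 + n12 * m21) * (n21 * m12 + n22 * m22)
                      - (n11 * m12 + n12 * m22) * (n21 * m11 + n22 * m21)); [ring|].
        replace (n11 * m11 + n12 * m21) with 1 by lra.
        replace (n21 * m12 + n22 * m22) with 1 by lra.
        replace (n11 * m12 + n12 * m22) with 0 by lra. ring. }
      assert (Hd1 : (m11 * m22 - m12 * m21) ^ 2 = 1).
      { set (d := m11 * m22 - m12 * m21) in *. set (d' := n11 * n22 - n12 * n21) in *.
        assert ((d' ^ 2) * (d ^ 2) = 1)
          by (replace (d' ^ 2 * d ^ 2) with ((d' * d) ^ 2) by ring; rewrite Hdet; ring).
        pose proof (pow2_ge_0 d). nra. }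
      set (A' := Q A B C m11 m21) in *.
      set (B' := A * m11 * m12 + B * (m11 * m22 + m12 * m21) + C * m21 * m22) in *.
      set (C' := Q A B C m12 m22) in *.
      assert (ED : A' * C' - B' * B' = D).
      { transitivity ((m11 * m22 - m12 * m21) ^ 2 * D); [unfold A', B', C', Q, D; ring|].
        rewrite Hd1. ring. }
      destruct HK as [PA [PC [HB HQ]]]. destruct HK' as [PA' [PC' [HB' HQ']]].
      destruct (det_average_unique A B C A' B' C' D) as [EA [EB EC]]; trivial.
      - assert (Kavg : K ((A + A') / 2) ((B + B') / 2) ((C + C') / 2)).
        { split; [lra|split; [lra|split]].
          - assert (HS2 : 0 <= A * C' + A' * C - 2 * B * B').
            { assert (NA : 0 < A)
                by (destruct PA as [|EA]; trivial; subst A; unfold D in PD; nra).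
              assert (NA' : 0 < A')
                by (destruct PA' as [|EA]; trivial; rewrite <- EA in ED; nra).
              assert (E : A * A' * (A * C' + A' * C - 2 * B * B') =
                D * (A ^ 2 + A' ^ 2) + (A * B' - A' * B) ^ 2).
              { replace (D * (A ^ 2 + A' ^ 2)) with (D * A ^ 2 + D * A' ^ 2) by ring.
                rewrite <- ED at 1. unfold D. ring. }
              pose proof (pow2_ge_0 (A * B' - A' * B)). pose proof (pow2_ge_0 A).
              pose proof (pow2_ge_0 A').
              assert (0 < A * A') by (apply Rmult_lt_0_compat; trivial).
              assert (0 <= D * (A ^ 2 + A' ^ 2)) by (apply Rmult_le_pos; lra).
              apply (Rmult_le_reg_l (A * A')); lra. }
            lra.
          - intros a b. pose proof (HQ a b). pose proof (HQ' a b). unfold Q in *. lra. }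
        specialize (Hmax _ _ _ Kavg). unfold D. lra.
      - unfold q at 1. rewrite (Hco v) at 1 2. rewrite ET, Hco'. simpl. unfold q.
        set (a := fst (co v)). set (b := snd (co v)).
        transitivity (Q A' B' C' a b); [unfold A', B', C', Q; ring|].
        rewrite EA, EB, EC. reflexivity. }
    assert (Hlin1 : bounded_functional (fun v => fst (co v))).
    { split; [|split].
      - intros v w. rewrite (Hco v), (Hco w) at 1.
        replace (fst (co v) *v x1 +v snd (co v) *v x2 +v (fst (co w) *v x1 +v snd (co w) *v x2))
          with ((fst (co v) + fst (co w)) *v x1 +v (snd (co v) + snd (co w)) *v x2) by vlin.
        rewrite Hco'. reflexivity.
      - intros a v. rewrite (Hco v) at 1.
        replace (a *v (fst (co v) *v x1 +v snd (co v) *v x2))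
          with ((a * fst (co v)) *v x1 +v (a * snd (co v)) *v x2) by vlin.
        rewrite Hco'. reflexivity.
      - exists c0. intros v. rewrite (Hco v) at 2. apply Hc. }
    assert (Hlin2 : bounded_functional (fun v => snd (co v))).
    { split; [|split].
      - intros v w. rewrite (Hco v), (Hco w) at 1.
        replace (fst (co v) *v x1 +v snd (co v) *v x2 +v (fst (co w) *v x1 +v snd (co w) *v x2))
          with ((fst (co v) + fst (co w)) *v x1 +v (snd (co v) + snd (co w)) *v x2) by vlin.
        rewrite Hco'. reflexivity.
      - intros a v. rewrite (Hco v) at 1.
        replace (a *v (fst (co v) *v x1 +v snd (co v) *v x2))
          with ((a * fst (co v)) *v x1 +v (a * snd (co v)) *v x2) by vlin.
        rewrite Hco'. reflexivity.
      - exists c0. intros v. rewrite (Hco v) at 2. apply Hc. }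
    (* Coordinates are bounded functionals, so the invariant [q] passes to weak limits along the
       orbit of [u]. *)
    assert (Hsphere : forall y, vnorm y = 1 -> q y = q u).
    { intros y Hy.
      destruct (approaches_weak X u y HL (proj1 Hu) Hy (big_point_approaches X u y Hu Hy))
        as [T [_ [HT [_ [_ [_ [Hw _]]]]]]].
      apply (UL_sequence (fun n => q (T n u))).
      - unfold q, Q. pose proof (Hw _ Hlin1) as W1. pose proof (Hw _ Hlin2) as W2.
        apply CV_plus; [apply CV_plus|]; apply CV_mult; try apply Un_cv_const;
          apply CV_mult; trivial.
      - apply Un_cv_ext with (2 := Un_cv_const (q u)). intros n. symmetry. apply Hinv, HT. }
    assert (Hhom : forall r a b, Q A B C (r * a) (r * b) = r ^ 2 * Q A B C a b)
      by (intros; unfold Q; ring).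
    assert (Hall : forall a b, Q A B C a b = q u * N a b ^ 2).
    { intros a b. destruct (classic (a *v x1 +v b *v x2 = 0v)) as [E|Ne].
      - destruct (Hi _ _ E) as [-> ->]. unfold N, Q.
        replace (0 *v x1 +v 0 *v x2) with (0v : X) by vlin. rewrite vnorm_0. ring.
      - pose proof (vnorm_gt0 X _ Ne) as Pv. fold (N a b) in Pv.
        assert (H1 : vnorm (/ N a b *v (a *v x1 +v b *v x2)) = 1).
        { rewrite vnorm_scal, Rabs_pos_eq by (left; apply Rinv_0_lt_compat; trivial).
          fold (N a b). field. lra. }
        pose proof (Hsphere _ H1) as H2. unfold q at 1 in H2.
        replace (/ N a b *v (a *v x1 +v b *v x2))
          with ((/ N a b * a) *v x1 +v (/ N a b * b) *v x2) in H2 by vlin.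
        rewrite Hco' in H2. simpl in H2. rewrite Hhom in H2. rewrite <- H2. field. lra. }
    assert (Nq : q u <> 0).
    { intros E. pose proof (Hall 1 0) as H. rewrite E in H. unfold Q in H.
      assert (A = 0) by lra. subst A. unfold D in PD. nra. }
    exists (A / q u), (B / q u), (C / q u). intros a b.
    pose proof (Hall a b) as H. unfold Q, N in H.
    apply (Rmult_eq_reg_l (q u)); trivial. rewrite <- H. field; trivial.
Qed.

Lemma pythagoras_dim2 (X : NormedSpace) (u x h : X) :
  rotund_with_projections X -> omega_LUR X -> big_point u -> indep2 x h ->
  (forall v : X, exists a b, v = a *v x +v b *v h) -> nearest x h = 0 ->
  forall t, vnorm (h +v t *v x) ^ 2 = vnorm h ^ 2 + t ^ 2 * vnorm x ^ 2.
Proof.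
  intros HX HL Hu Hi Hspan Hxh t.
  destruct (quadratic_norm_dim2 X u x h HX HL Hu Hi Hspan) as [A [B [C HQ]]].
  assert (Nx : x <> 0v) by (intros E; destruct (Hi 1 0) as [? _]; [rewrite E; vlin|lra]).
  assert (Hv : forall s, vnorm (h +v s *v x) ^ 2 = A * (s * s) + 2 * B * s + C).
  { intros s. replace (h +v s *v x) with (s *v x +v 1 *v h) by vlin. rewrite HQ. ring. }
  assert (HA : vnorm x ^ 2 = A).
  { replace x with (1 *v x +v 0 *v h) by vlin. rewrite HQ. ring. }
  assert (HC : vnorm h ^ 2 = C).
  { replace h with (0 *v x +v 1 *v h) by vlin. rewrite HQ. ring. }
  assert (PA : 0 < A) by (rewrite <- HA; apply pow_lt, vnorm_gt0; trivial).
  (* [- B / A] minimizes the quadratic polynomial of [Hv], while orthogonality puts the minimum at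
     0. *)
  assert (HB : B = 0).
  { pose proof (proj1 (nearest_eq0 X x h HX Nx) Hxh (- B / A)) as H.
    assert (H2 : vnorm h ^ 2 <= vnorm (h +v (- B / A) *v x) ^ 2)
      by (apply pow_incr; split; [apply vnorm_ge0|trivial]).
    rewrite Hv, HC in H2.
    assert (H3 : A * (- B / A * (- B / A)) + 2 * B * (- B / A) = - (B * B) / A) by (field; lra).
    assert (H4 : B * B <= 0).
    { assert (0 <= - (B * B) / A) by lra.
      apply (Rmult_le_compat_l A) in H0; [|lra].
      replace (A * (- (B * B) / A)) with (- (B * B)) in H0 by (field; lra). lra. }
    nra. }
  rewrite Hv, HA, HC, HB. ring.
Qed.

(** * The inner product *)

Lemma pythagoras (X : NormedSpace) (u x h : X) :
  rotund_with_projections X -> omega_LUR X -> big_point u -> x <> 0v -> nearest x h = 0 ->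
  forall t, vnorm (h +v t *v x) ^ 2 = vnorm h ^ 2 + t ^ 2 * vnorm x ^ 2.
Proof.
  intros HX HL Hu Nx Hxh t.
  destruct (indep2_or_multiple X x h Nx) as [Hi|[c E]].
  - destruct (classic (forall v : X, exists a b, v = a *v x +v b *v h)) as [Hs|Hs].
    + apply (pythagoras_dim2 X u); trivial.
    + apply not_all_ex_not in Hs. destruct Hs as [w Hw].
      apply (pythagoras_dim3 X x h w); trivial. intros a b c E.
      assert (Hc : c = 0).
      { apply NNPP. intros Nc. apply Hw. exists (- a / c), (- b / c).
        replace w with (/ c *v (a *v x +v b *v h +v c *v w) +v (- a / c) *v x +v (- b / c) *v h)
          at 1 by vlin.
        rewrite E. vlin. }
      subst c. destruct (Hi a b) as [-> ->]; auto. rewrite <- E. vlin.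
  - rewrite E, (proj2 (nearest_linear X x HX Nx)), nearest_self in Hxh by trivial.
    assert (c = 0) by lra. subst c. rewrite E.
    replace (0 *v x +v t *v x) with (t *v x) by vlin.
    replace (0 *v x) with (0v : X) by vlin.
    rewrite vnorm_0, vnorm_scal, Rpow_mult_distr, pow2_abs. ring.
Qed.

Lemma hilbert_of_projections (X : NormedSpace) (u : X) :
  rotund_with_projections X -> omega_LUR X -> big_point u -> is_hilbert X.
Proof.
  intros HX HL Hu.
  (* Polarization makes symmetry immediate. Linearity comes from [y +v x] and [y -v x] being
     [h + (g + 1) x] and [h + (g - 1) x] with [h] orthogonal to [x]: the squares differ by
     [4 g * vnorm x ^ 2]. *)
  set (ip := fun y x : X => (vnorm (y +v x) ^ 2 - vnorm (y -v x) ^ 2) / 4).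
  assert (Hip : forall x y, x <> 0v -> ip y x = vnorm x ^ 2 * nearest x y).
  { intros x y Nx. pose proof (nearest_linear X x HX Nx) as [GA GS].
    set (g := nearest x y) in *. set (h := y +v (- g) *v x).
    assert (Hh : nearest x h = 0).
    { unfold h. rewrite GA, GS, nearest_self by trivial. fold g. ring. }
    pose proof (pythagoras X u x h HX HL Hu Nx Hh) as HP. unfold ip.
    replace (y +v x) with (h +v (g + 1) *v x) by (unfold h; vlin).
    replace (y -v x) with (h +v (g - 1) *v x) by (unfold h; vlin).
    rewrite !HP. field. }
  assert (Hip0 : forall y, ip y 0v = 0).
  { intros y. unfold ip. replace (y +v 0v) with y by vlin. replace (y -v 0v) with y by vlin.
    field. }
  exists ip. split; [|split; [|split]].
  - intros x y z. destruct (classic (z = 0v)) as [->|Nz].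
    + rewrite !Hip0. ring.
    + rewrite !Hip, (proj1 (nearest_linear X z HX Nz)) by trivial. ring.
  - intros a x y. destruct (classic (y = 0v)) as [->|Ny].
    + rewrite !Hip0. ring.
    + rewrite !Hip, (proj2 (nearest_linear X y HX Ny)) by trivial. ring.
  - intros x y. unfold ip. rewrite (vadd_comm X x y), <- (vnorm_opp X (x -v y)).
    replace (vopp (x -v y)) with (y -v x) by vlin. reflexivity.
  - intros x. unfold ip. replace (x +v x) with (2 *v x) by vlin.
    replace (x -v x) with (0v : X) by vlin.
    rewrite vnorm_0, vnorm_scal, Rabs_pos_eq by lra. field.
Qed.

Theorem theorem3p3 (X : NormedSpace) :
  complete X ->
  omega_LUR X ->
  (exists u : X, vnorm u = 1 /\ big_point u) ->
  (forall eps : R, eps > 0 ->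
     exists Z : X -> Prop,
       subspace Z /\ closed_subset Z /\ codim1 Z /\
       exists P : X -> X, lin_projection_onto Z P /\ op_norm_le P (1 + eps)) ->
  is_hilbert X.
Proof.
  intros _ HL [u [_ Hu]] HZ. apply (hilbert_of_projections X u); trivial.
  split; [apply omega_LUR_imp_rotund; trivial|].
  apply near_projections_limit. intros x y1 y2 eps Hx Heps.
  destruct (HZ eps Heps) as [Z [_ [_ [Hcodim [P [HP HPn]]]]]].
  destruct (projection_functional X Z P (1 + eps) Hcodim HP HPn) as [f [v [Hf [Hv [Hfv Hfn]]]]].
  destruct (approaches_weak X v x HL Hv Hx (approaches_all X u v x HL Hu Hv Hx))
    as [T [S [HT [HS [_ [HTS [Hw Hw']]]]]]].
  apply (weak_projection_limit X f v x (1 + eps) T S y1 y2); trivial.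
Qed.
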